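(* Let $\alpha\in\mathbb{C}\setminus\{-1,-2,\dotsc\}$. Then $$\sum_{k=1}^{\infty}\binom{2k}{k}\frac{1}{\alpha+k}\frac{1}{4^k}=\begin{cases}\dfrac{\sqrt\pi\,\Gamma(\alpha)}{\Gamma\bigl(\frac12+\alpha\bigr)}-\dfrac1\alpha, & \alpha\ne0,\\[2mm] 2\ln2, & \alpha=0.\end{cases}$$ Moreover, if $\alpha\ne0$, then for every integer $n\ge1$, $$\sum_{k=1}^{n}\binom{2k}{k}\frac{1}{\alpha+k}\frac{1}{4^k}=\frac{\sqrt\pi\,\Gamma(\alpha)}{\Gamma\bigl(\frac12+\alpha\bigr)}-\frac1\alpha-\frac{1}{1+\alpha+n}\,\frac{(1+2n)!!}{(2+2n)!!}\;{}_3F_2\bigl(1,\tfrac32+n,1+\alpha+n;2+n,2+\alpha+n;1\bigr).$$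
   Context: $\Gamma$ is the Euler gamma function, with $1/\Gamma(w)=0$ for $w\in\{0,-1,-2,\dotsc\}$. The generalized hypergeometric function is ${}_3F_2(a_1,a_2,a_3;b_1,b_2;z)=\sum_{m=0}^{\infty}\frac{(a_1)_m(a_2)_m(a_3)_m}{(b_1)_m(b_2)_m}\frac{z^m}{m!}$, where $(a)_0=1$ and $(a)_m=a(a+1)\dotsm(a+m-1)$ for $m\ge1$; the series in the claim converges at $z=1$. $m!!$ is the double factorial, the product $m(m-2)(m-4)\dotsm$ ending in $1$ or $2$. *)

(* Defs.v *)
From Stdlib Require Import Reals Factorial ClassicalEpsilon.
From Coquelicot Require Import Coquelicot.

Open Scope R_scope.

Definition Cexp (z : C) : C :=
  (exp (Re z) * cos (Im z), exp (Re z) * sin (Im z)).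

(* t^w = e^(w ln t), meaningful for t > 0. *)
Definition Rpow_C (t : R) (w : C) : C := Cexp (w * RtoC (ln t))%C.

Fixpoint pochhammer (a : C) (m : nat) : C :=
  match m with
  | O => RtoC 1
  | S p => (pochhammer a p * (a + RtoC (INR p)))%C
  end.

Definition Gamma_integrand (z : C) (t : R) : C :=
  (Rpow_C t (z - RtoC 1) * RtoC (exp (- t)))%C.

(* Euler's integral of t^(z-1) e^(-t) over (0, +oo), taken componentwise; it
   converges for Re z > 0. *)
Definition Gamma_integral (z : C) : C :=
  (RInt_gen (fun t => Re (Gamma_integrand z t))
            (at_right 0) (Rbar_locally p_infty),
   RInt_gen (fun t => Im (Gamma_integrand z t))
            (at_right 0) (Rbar_locally p_infty)).

(* The least N with Re z + N > 0; in particular 0 when Re z > 0. *)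
Definition Gamma_shift (z : C) : nat := Z.to_nat (up (- Re z)).

(* Euler's integral for Re z > 0, continued to Re z <= 0 by the functional
   equation: Gamma z = Gamma (z + N) / (z (z + 1) ... (z + N - 1)).
   The value at the poles 0, -1, -2, ... is meaningless. *)
Definition Gamma (z : C) : C :=
  let N := Gamma_shift z in
  (Gamma_integral (z + RtoC (INR N)) / pochhammer z N)%C.

(* 1 / Gamma, with value 0 at the poles of Gamma. *)
Definition rGamma (w : C) : C :=
  if excluded_middle_informative (exists k : nat, w = (- RtoC (INR k))%C)
  then RtoC 0
  else (/ Gamma w)%C.

(* Sum of a convergent complex series; arbitrary value if a diverges. *)
Definition CSeries (a : nat -> C) : C :=
  (Series (fun m => Re (a m)), Series (fun m => Im (a m))).

Definition hyp3F2_term (a1 a2 a3 b1 b2 z : C) (m : nat) : C :=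
  (pochhammer a1 m * pochhammer a2 m * pochhammer a3 m
     / (pochhammer b1 m * pochhammer b2 m)
     * (z ^ m / RtoC (INR (fact m))))%C.

Definition hyp3F2 (a1 a2 a3 b1 b2 z : C) : C :=
  CSeries (hyp3F2_term a1 a2 a3 b1 b2 z).

Fixpoint double_fact (m : nat) : nat :=
  match m with
  | O => 1
  | S O => 1
  | S (S p) => m * double_fact p
  end%nat.

(* Coquelicot's [C] hides the real-valued binomial coefficient of Stdlib. *)
Definition binom_term (alpha : C) (k : nat) : C :=
  (RtoC (Binomial.C (2 * k) k) * (RtoC 1 / (alpha + RtoC (INR k)))
     * (RtoC 1 / RtoC 4 ^ k))%C.

(* Main.v *)
Require Import Defs.
From Stdlib Require Import Reals Lra Lia Factorial ClassicalEpsilon.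
From Coquelicot Require Import Coquelicot.

Open Scope R_scope.

(** Write c_k = binom(2k,k)/4^k and F(a) = sum_(k>=0) c_k/(a+k), so that the sum in question is
    F(alpha) - 1/alpha. Telescoping gives a F(a) = (a+1/2) F(a+1), hence
    (a)_n F(a) = (a+1/2)_n F(a+n). Since F(1) = 2, the values F(n+1) are Wallis integrals and
    sqrt n F(n+1) -> sqrt pi; termwise comparison extends this to sqrt n F(a+n) -> sqrt pi.
    On the other side Gamma(z+n) ~ (n-1)! n^z: the quotient is the mean of (T/n)^z for T with
    density t^(n-1) e^(-t)/(n-1)!, and T/n concentrates at 1 by its polynomial moments.
    Letting n -> oo, F(a) Gamma(a+1/2) = sqrt pi Gamma(a), and the same asymptotics show that
    Gamma has no zeros; if a+1/2 is a pole of Gamma, the factor (a+1/2)_n kills F(a).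
    For alpha = 0, Abel summation of sum c_k x^k/k = 2 ln 2 - 2 ln (1 + sqrt (1-x)) is used. *)

(** * Central binomial coefficients and Wallis integrals *)

(** Where defined, the quotient of F(a) by sqrt pi Gamma(a) / Gamma(a+1/2) is 1-periodic, since both
    satisfy the same first-order recurrence; its limit along a + n therefore decides the identity.
    The classical route identifies F(a) with the beta integral B(a, 1/2), but that integral
    converges only for Re a > 0, and the remaining a would call for analytic continuation. Shifting
    by n treats every admissible a at once, and it suits a Gamma that is itself defined by an
    integral and a finite shift. Only real integrals in one variable occur. Polynomial moments are
    enough for the concentration step because s^z - 1 is bounded by a polynomial in s times |s - 1|.
    The finite identity needs no further analysis, since the hypergeometric expression is, term by
    term, the tail of the same series. *)

Lemma is_lim_seq_inv_INR_plus (c : R) : is_lim_seq (fun n => / (INR n + c)) 0.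
Proof.
replace (Finite 0) with (Rbar_inv p_infty) by reflexivity.
apply is_lim_seq_inv; [|discriminate].
apply is_lim_seq_plus with p_infty c; [apply is_lim_seq_INR|apply is_lim_seq_const|reflexivity].
Qed.

Definition cbin (k : nat) : R := Binomial.C (2 * k) k / 4 ^ k.

Lemma cbin_0 : cbin 0 = 1.
Proof. unfold cbin, Binomial.C; simpl; field. Qed.

Lemma cbin_S (k : nat) : cbin (S k) * INR (S k) = (INR k + / 2) * cbin k.
Proof.
unfold cbin, Binomial.C.
replace (2 * S k)%nat with (S (S (2 * k))) by lia.
replace (S (S (2 * k)) - S k)%nat with (S k) by lia.
replace (2 * k - k)%nat with k by lia.
rewrite !fact_simpl, !mult_INR, !S_INR, mult_INR, <- tech_pow_Rmult.
simpl (INR 2).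
pose proof (INR_fact_neq_0 k). pose proof (pos_INR k).
assert (4 ^ k <> 0) by (apply pow_nonzero; lra).
field; repeat split; auto; lra.
Qed.

Lemma cbin_pos (k : nat) : 0 < cbin k.
Proof.
induction k as [|k IH]; [rewrite cbin_0; lra|].
pose proof (cbin_S k) as E. pose proof (pos_INR k). rewrite S_INR in E.
apply (Rmult_lt_reg_r (INR k + 1)); [lra|]. rewrite E. nra.
Qed.

(** The weight 2k+1 makes the induction close: passing from k to k+1 multiplies the left side by
    (2k+1)(2k+3)/(2k+2)^2 < 1. The bound yields c_k -> 0. *)
Lemma cbin_sq_bound (k : nat) : cbin k ^ 2 * (2 * INR k + 1) <= 1.
Proof.
induction k as [|k IH]; [rewrite cbin_0; simpl; lra|].
pose proof (cbin_S k) as E. pose proof (pos_INR k). rewrite S_INR in *.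
assert (E' : cbin (S k) = (INR k + / 2) * cbin k / (INR k + 1))
  by (apply (Rmult_eq_reg_r (INR k + 1)); [rewrite E; field|]; lra).
rewrite E'. apply Rle_trans with (2 := IH).
replace (((INR k + / 2) * cbin k / (INR k + 1)) ^ 2 * (2 * (INR k + 1) + 1))
  with (cbin k ^ 2 * ((INR k + / 2) ^ 2 * (2 * (INR k + 1) + 1) / (INR k + 1) ^ 2)) by (field; lra).
apply Rmult_le_compat_l; [apply pow2_ge_0|].
apply Rle_div_l; [apply Rlt_gt; nra|]. nra.
Qed.

Lemma cbin_lim : is_lim_seq cbin 0.
Proof.
apply is_lim_seq_le_le with (u := fun _ => 0) (w := fun n => sqrt (/ (INR n + 1))).
- intros n. split; [apply Rlt_le, cbin_pos|].
  pose proof (cbin_pos n). pose proof (cbin_sq_bound n). pose proof (pos_INR n).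
  rewrite <- (sqrt_pow2 (cbin n)) by lra. apply sqrt_le_1_alt.
  apply (Rmult_le_reg_r (INR n + 1)); [lra|].
  rewrite Rinv_l by lra. nra.
- apply is_lim_seq_const.
- replace (Finite 0) with (Finite (sqrt 0)) by (now rewrite sqrt_0).
  apply is_lim_seq_continuous; [apply continuity_pt_sqrt; lra|].
  apply is_lim_seq_inv_INR_plus.
Qed.

(** The recurrence says c_k/(k+1) = 2 (c_k - c_(k+1)), so the sum telescopes. The resulting series
    gives F(1) and also serves as the majorant for every F(a). *)
Lemma sum_cbin_succ (n : nat) :
  sum_n (fun k => cbin k / INR (S k)) n = 2 * (1 - cbin (S n)).
Proof.
induction n as [|n IH].
- rewrite sum_O. pose proof (cbin_S 0) as E. rewrite cbin_0 in *. simpl in *. lra.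
- rewrite sum_Sn, IH. change (2 * (1 - cbin (S n)) + cbin (S n) / INR (S (S n)) = 2 * (1 - cbin (S (S n)))).
  pose proof (cbin_S (S n)) as E. pose proof (pos_INR n).
  rewrite !S_INR in *.
  assert (E' : cbin (S (S n)) = (INR n + 1 + / 2) * cbin (S n) / (INR n + 1 + 1))
  by (apply (Rmult_eq_reg_r (INR n + 1 + 1)); [rewrite E; field|]; lra).
  rewrite E'. field. lra.
Qed.

Lemma is_series_cbin_succ : is_series (fun k => cbin k / INR (S k)) 2.
Proof.
change (is_lim_seq (sum_n (fun k => cbin k / INR (S k))) 2).
apply (is_lim_seq_ext (fun n => 2 * (1 - cbin (S n)))).
- intros n; symmetry; apply sum_cbin_succ.
- replace (Finite 2) with (Finite (2 * (1 - 0))) by (f_equal; ring).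
  apply is_lim_seq_mult'; [apply is_lim_seq_const|].
  apply is_lim_seq_minus'; [apply is_lim_seq_const|].
  apply -> is_lim_seq_incr_1. apply cbin_lim.
Qed.

Definition wallis (n : nat) : R := RInt (fun x => sin x ^ n) 0 (PI / 2).

Lemma ex_RInt_sin_pow (n : nat) a b : ex_RInt (fun x => sin x ^ n) a b.
Proof.
apply (ex_RInt_continuous (V := R_CompleteNormedModule)). intros x _.
apply (ex_derive_continuous (fun x => sin x ^ n)). auto_derive; auto.
Qed.

Lemma wallis_0 : wallis 0 = PI / 2.
Proof. unfold wallis. simpl. rewrite RInt_const. unfold scal; simpl; unfold mult; simpl. lra. Qed.

Lemma wallis_1 : wallis 1 = 1.
Proof.
apply is_RInt_unique.
replace 1 with (minus (- cos (PI / 2)) (- cos 0))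
  by (rewrite cos_PI2, cos_0; unfold minus, plus, opp; simpl; lra).
apply (is_RInt_derive (V := R_CompleteNormedModule) (fun x => - cos x)).
- intros x _. auto_derive; auto; ring.
- intros x _. apply (ex_derive_continuous (fun x => sin x ^ 1)). auto_derive; auto.
Qed.

(** The derivative of cos x sin^(n+1) x is (n+1) sin^n x - (n+2) sin^(n+2) x, and the function
    vanishes at 0 and at pi/2. *)
Lemma wallis_SS (n : nat) : INR (n + 2) * wallis (n + 2) = INR (n + 1) * wallis n.
Proof.
assert (H : is_RInt (fun x => INR (n + 1) * sin x ^ n - INR (n + 2) * sin x ^ (n + 2)) 0 (PI / 2)
   (minus (cos (PI / 2) * sin (PI / 2) ^ (n + 1)) (cos 0 * sin 0 ^ (n + 1)))).
{ apply (is_RInt_derive (V := R_CompleteNormedModule) (fun x => cos x * sin x ^ (n + 1))).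
  - intros x _. auto_derive; auto.
    replace (Init.Nat.pred (n + 1)) with n by lia.
    rewrite !pow_add, !plus_INR. simpl. pose proof (sin2_cos2 x) as E. unfold Rsqr in E.
    replace (cos x * (1 * cos x * ((INR n + 1) * sin x ^ n))) with
      ((cos x * cos x) * ((INR n + 1) * sin x ^ n)) by ring.
    replace (cos x * cos x) with (1 - sin x * sin x) by lra.
    ring.
  - intros x _. apply (ex_derive_continuous
      (fun x => INR (n + 1) * sin x ^ n - INR (n + 2) * sin x ^ (n + 2))). auto_derive; auto. }
apply (is_RInt_unique (V := R_CompleteNormedModule)) in H.
rewrite (RInt_minus (V := R_CompleteNormedModule) (fun x => INR (n + 1) * sin x ^ n)
  (fun x => INR (n + 2) * sin x ^ (n + 2))) in H
  by (apply (ex_RInt_scal (V := R_NormedModule)), ex_RInt_sin_pow).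
rewrite (RInt_scal (V := R_CompleteNormedModule) (fun x => sin x ^ n)),
  (RInt_scal (V := R_CompleteNormedModule) (fun x => sin x ^ (n + 2))) in H by apply ex_RInt_sin_pow.
fold (wallis n) (wallis (n + 2)) in H.
rewrite cos_PI2, sin_0, (pow_ne_zero (n + 1)) in H by lia.
unfold minus, plus, opp, scal in H; simpl in H; unfold mult in H; simpl in H. lra.
Qed.

Lemma wallis_antitone (n : nat) : wallis (n + 1) <= wallis n.
Proof.
pose proof PI_RGT_0.
apply RInt_le; try apply ex_RInt_sin_pow; [lra|].
intros x Hx. rewrite pow_add, pow_1.
pose proof (sin_gt_0 x). pose proof (SIN_bound x). pose proof (pow_le (sin x) n). nra.
Qed.

(** By [wallis_SS] the left side does not depend on n; at n = 0 it is the product of [wallis 0] and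
    [wallis 1]. *)
Lemma wallis_mul (n : nat) : INR (n + 1) * (wallis n * wallis (n + 1)) = PI / 2.
Proof.
induction n as [|n IH].
- simpl (0 + 1)%nat. rewrite wallis_0, wallis_1. simpl; lra.
- rewrite <- IH. replace (S n + 1)%nat with (n + 2)%nat by lia.
  replace (S n) with (n + 1)%nat by lia.
  transitivity ((INR (n + 2) * wallis (n + 2)) * wallis (n + 1)); [ring|].
  rewrite wallis_SS. ring.
Qed.

Lemma wallis_pos (n : nat) : 0 < wallis n.
Proof.
pose proof PI_RGT_0.
apply RInt_gt_0; [lra| |].
- intros x Hx. apply pow_lt, sin_gt_0; lra.
- intros x Hx. apply continuity_pt_filterlim, continuity_pt_filterlim.
  apply (ex_derive_continuous (fun x => sin x ^ n)). auto_derive; auto.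
Qed.

(** Monotonicity places W_(n+1)^2 between W_(n+1) W_(n+2) and W_n W_(n+1), and [wallis_mul]
    evaluates both products exactly. *)
Lemma wallis_sq_bounds (n : nat) :
  PI / 2 / INR (n + 2) <= wallis (n + 1) ^ 2 <= PI / 2 / INR (n + 1).
Proof.
pose proof (wallis_mul n) as E1. pose proof (wallis_mul (n + 1)) as E2.
pose proof (wallis_antitone n). pose proof (wallis_antitone (n + 1)).
replace (n + 1 + 1)%nat with (n + 2)%nat in * by lia.
pose proof (wallis_pos (n + 1)).
assert (0 < INR (n + 1)) by (apply lt_0_INR; lia).
assert (0 < INR (n + 2)) by (apply lt_0_INR; lia).
split.
- apply Rle_div_l; [lra|]. rewrite <- E2.
  replace (wallis (n + 1) ^ 2 * INR (n + 2)) with (INR (n + 2) * (wallis (n + 1) * wallis (n + 1))) by ring.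
  apply Rmult_le_compat_l; [lra|]. apply Rmult_le_compat_l; lra.
- apply -> Rle_div_r; [|lra]. rewrite <- E1.
  replace (wallis (n + 1) ^ 2 * INR (n + 1)) with (INR (n + 1) * (wallis (n + 1) * wallis (n + 1))) by ring.
  apply Rmult_le_compat_l; [lra|]. apply Rmult_le_compat_r; lra.
Qed.

Lemma is_lim_seq_INR_ratio (a b c : R) : 0 < b ->
  0 < c -> is_lim_seq (fun n => a * INR n / (b * INR n + c)) (a / b).
Proof.
intros Hb Hc.
apply (is_lim_seq_ext (fun n => a / b - a * c / (b * b) * / (INR n + c / b))).
- intros n. pose proof (pos_INR n). pose proof (Rdiv_lt_0_compat c b Hc Hb). field.
  repeat split; nra.
- replace (Finite (a / b)) with (Finite (a / b - a * c / (b * b) * 0)) by (f_equal; ring).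
  apply is_lim_seq_minus'; [apply is_lim_seq_const|].
  apply is_lim_seq_mult'; [apply is_lim_seq_const|apply is_lim_seq_inv_INR_plus].
Qed.

(** The factor [2 * wallis (2 * n + 1)] is the value F(n+1), by [beta_sum_INR_S] below. Squaring
    reduces the limit to rational bounds. *)
Lemma wallis_lim : is_lim_seq (fun n => sqrt (INR n) * (2 * wallis (2 * n + 1))) (sqrt PI).
Proof.
apply (is_lim_seq_ext (fun n => sqrt (4 * INR n * wallis (2 * n + 1) ^ 2))).
{ intros n. pose proof (pos_INR n). pose proof (wallis_pos (2 * n + 1)).
  replace (4 * INR n * wallis (2 * n + 1) ^ 2) with (INR n * (2 * wallis (2 * n + 1)) ^ 2) by ring.
  rewrite sqrt_mult, sqrt_pow2; try lra. apply pow2_ge_0. }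
apply is_lim_seq_continuous; [apply continuity_pt_sqrt, Rlt_le, PI_RGT_0|].
apply is_lim_seq_le_le with
  (u := fun n => 2 * PI * INR n / (2 * INR n + 2))
  (w := fun n => 2 * PI * INR n / (2 * INR n + 1)).
- intros n. pose proof (pos_INR n). pose proof PI_RGT_0.
  destruct (wallis_sq_bounds (2 * n)) as [H1 H2].
  rewrite !plus_INR, mult_INR in *.
  change (INR 2) with 2 in *. change (INR 1) with 1 in *.
  split.
  + apply Rle_trans with (4 * INR n * (PI / 2 / (2 * INR n + 2))).
    * apply Req_le. field. lra.
    * apply Rmult_le_compat_l; lra.
  + apply Rle_trans with (4 * INR n * (PI / 2 / (2 * INR n + 1))).
    * apply Rmult_le_compat_l; lra.
    * apply Req_le. field. lra.
- replace (Finite PI) with (Finite (2 * PI / 2)) by (f_equal; field).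
  apply is_lim_seq_INR_ratio; lra.
- replace (Finite PI) with (Finite (2 * PI / 2)) by (f_equal; field).
  apply is_lim_seq_INR_ratio; lra.
Qed.

(** * The series F *)

(** Taken componentwise because [CSeries] and [Gamma_integral] are, so that the real limit lemmas
    apply directly. *)
Definition Clim (u : nat -> C) (l : C) : Prop :=
  is_lim_seq (fun n => Re (u n)) (Re l) /\ is_lim_seq (fun n => Im (u n)) (Im l).

Lemma C_eq (z w : C) : Re z = Re w -> Im z = Im w -> z = w.
Proof. destruct z, w; simpl; intros; now f_equal. Qed.

Lemma Clim_ext u v l : (forall n, u n = v n) -> Clim u l -> Clim v l.
Proof.
intros H [H1 H2]; split; [apply is_lim_seq_ext with (2 := H1)|apply is_lim_seq_ext with (2 := H2)];
  intros n; now rewrite H.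
Qed.

Lemma Clim_unique u l l' : Clim u l -> Clim u l' -> l = l'.
Proof.
intros [H1 H2] [H3 H4]; apply C_eq.
- apply is_lim_seq_unique in H1; apply is_lim_seq_unique in H3; congruence.
- apply is_lim_seq_unique in H2; apply is_lim_seq_unique in H4; congruence.
Qed.

Lemma Clim_const l : Clim (fun _ => l) l.
Proof. split; apply is_lim_seq_const. Qed.

Lemma Clim_RtoC (u : nat -> R) (l : R) : is_lim_seq u l -> Clim (fun n => RtoC (u n)) (RtoC l).
Proof. intros H; split; simpl; [exact H|apply is_lim_seq_const]. Qed.

Lemma Clim_plus u v l m : Clim u l -> Clim v m -> Clim (fun n => u n + v n)%C (l + m)%C.
Proof. intros [] []; split; simpl; now apply is_lim_seq_plus'. Qed.

Lemma Clim_opp u l : Clim u l -> Clim (fun n => - u n)%C (- l)%C.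
Proof. intros [H1 H2]; split; simpl; [now apply is_lim_seq_opp in H1|now apply is_lim_seq_opp in H2]. Qed.

Lemma Clim_minus u v l m : Clim u l -> Clim v m -> Clim (fun n => u n - v n)%C (l - m)%C.
Proof. intros; apply Clim_plus; [|apply Clim_opp]; auto. Qed.

Lemma Clim_mult u v l m : Clim u l -> Clim v m -> Clim (fun n => u n * v n)%C (l * m)%C.
Proof.
intros [] []; split; simpl.
- apply is_lim_seq_minus'; now apply is_lim_seq_mult'.
- apply is_lim_seq_plus'; now apply is_lim_seq_mult'.
Qed.

Lemma Clim_incr_1 u l : Clim (fun n => u (S n)) l <-> Clim u l.
Proof.
split; intros [H1 H2]; split.
- apply (is_lim_seq_incr_1 (fun n => Re (u n))), H1.
- apply (is_lim_seq_incr_1 (fun n => Im (u n))), H2.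
- apply -> (is_lim_seq_incr_1 (fun n => Re (u n))); apply H1.
- apply -> (is_lim_seq_incr_1 (fun n => Im (u n))); apply H2.
Qed.

Lemma Rabs_Re_le z : Rabs (Re z) <= Cmod z.
Proof. eapply Rle_trans; [apply Rmax_l|apply Rmax_Cmod]. Qed.

Lemma Rabs_Im_le z : Rabs (Im z) <= Cmod z.
Proof. eapply Rle_trans; [apply Rmax_r|apply Rmax_Cmod]. Qed.

Lemma Clim_dominated u l v :
  (exists N, forall n, (N <= n)%nat -> Cmod (u n - l) <= v n) -> is_lim_seq v 0 -> Clim u l.
Proof.
intros [N H] Hv.
assert (Hv' : is_lim_seq (fun n => - v n) 0)
  by (replace (Finite 0) with (Rbar_opp 0) by (simpl; f_equal; ring); now apply -> is_lim_seq_opp).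
assert (K : forall f : nat -> R, forall x : R, (forall n, (N <= n)%nat -> Rabs (f n - x) <= v n) ->
  is_lim_seq f x).
{ intros f x Hf.
  apply (is_lim_seq_ext (fun n => (f n - x) + x)); [intros; ring|].
  replace (Finite x) with (Finite (0 + x)) by (f_equal; ring).
  apply is_lim_seq_plus'; [|apply is_lim_seq_const].
  apply is_lim_seq_le_le_loc with (u := fun n => - v n) (w := v); auto.
  exists N. intros n Hn. apply Rabs_le_between; auto. }
split; apply K; intros n Hn; specialize (H n Hn).
- eapply Rle_trans; [|apply H]. apply (Rabs_Re_le (u n - l)%C).
- eapply Rle_trans; [|apply H]. apply (Rabs_Im_le (u n - l)%C).
Qed.

Lemma Re_sum_n (a : nat -> C) n : Re (sum_n (G := C_AbelianMonoid) a n) = sum_n (fun k => Re (a k)) n.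
Proof. induction n as [|n IH]; [now rewrite !sum_O|]. now rewrite !sum_Sn, <- IH. Qed.

Lemma Im_sum_n (a : nat -> C) n : Im (sum_n (G := C_AbelianMonoid) a n) = sum_n (fun k => Im (a k)) n.
Proof. induction n as [|n IH]; [now rewrite !sum_O|]. now rewrite !sum_Sn, <- IH. Qed.

Local Notation is_Cseries := (is_series (K := C_AbsRing) (V := C_NormedModule)).
Local Notation ex_Cseries := (ex_series (K := C_AbsRing) (V := C_NormedModule)).
Local Notation Csum_n := (sum_n (G := C_AbelianMonoid)).

(** A ball of the uniform structure on C is a product of two real balls, so convergence there is
    convergence of both coordinates. *)
Lemma is_Cseries_Clim a l : is_Cseries a l <-> Clim (Csum_n a) l.
Proof.
unfold is_series. split.
- intros H. split.
  + apply (filterlim_locally (U := R_UniformSpace)). intros eps.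
    generalize (proj1 (filterlim_locally (U := C_UniformSpace) _ _) H eps).
    apply filter_imp. intros n Hn. apply Hn.
  + apply (filterlim_locally (U := R_UniformSpace)). intros eps.
    generalize (proj1 (filterlim_locally (U := C_UniformSpace) _ _) H eps).
    apply filter_imp. intros n Hn. apply Hn.
- intros [H1 H2]. apply (filterlim_locally (U := C_UniformSpace)). intros eps.
  generalize (proj1 (filterlim_locally (U := R_UniformSpace) _ _) H1 eps)
    (proj1 (filterlim_locally (U := R_UniformSpace) _ _) H2 eps).
  intros H3 H4. generalize (filter_and _ _ H3 H4).
  apply filter_imp. intros n [Hn Hn']. now split.
Qed.

Lemma is_Cseries_Re_Im a l : is_Cseries a l <->
  is_series (fun k => Re (a k)) (Re l) /\ is_series (fun k => Im (a k)) (Im l).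
Proof.
rewrite is_Cseries_Clim.
split; intros [H1 H2]; split.
- apply is_lim_seq_ext with (2 := H1); intros n; apply Re_sum_n.
- apply is_lim_seq_ext with (2 := H2); intros n; apply Im_sum_n.
- apply is_lim_seq_ext with (2 := H1); intros n; symmetry; apply Re_sum_n.
- apply is_lim_seq_ext with (2 := H2); intros n; symmetry; apply Im_sum_n.
Qed.

Lemma CSeries_unique a l : is_Cseries a l -> CSeries a = l.
Proof.
rewrite is_Cseries_Re_Im. intros [H1 H2].
apply C_eq; simpl; now apply is_series_unique.
Qed.

Lemma CSeries_correct a : ex_Cseries a -> is_Cseries a (CSeries a).
Proof. intros [l H]. now rewrite (CSeries_unique _ _ H). Qed.

Lemma Cmod_INR_ge (a : C) (k : nat) : INR k - Cmod a <= Cmod (a + RtoC (INR k)).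
Proof.
pose proof (Cmod_triangle (a + RtoC (INR k)) (- a)) as H.
rewrite Cmod_opp in H. replace (a + INR k + - a)%C with (RtoC (INR k)) in H by ring.
rewrite Cmod_R, Rabs_pos_eq in H by apply pos_INR. lra.
Qed.

Lemma RtoC_neq_0 x : x <> 0 -> RtoC x <> RtoC 0.
Proof. intros H E. now apply H, RtoC_inj. Qed.

(** * Convergence and functional equation of F *)

Lemma binom_term_cbin a k : binom_term a k = (RtoC (cbin k) * / (a + RtoC (INR k)))%C.
Proof.
unfold binom_term, cbin. rewrite RtoC_div, RtoC_pow by (apply pow_nonzero; lra).
unfold Cdiv. ring.
Qed.

Lemma Cmod_binom_term a k : 0 < Cmod (a + RtoC (INR k)) ->
  Cmod (binom_term a k) = cbin k / Cmod (a + RtoC (INR k)).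
Proof.
intros H. rewrite binom_term_cbin, Cmod_mult, Cmod_inv by now apply Cmod_gt_0.
rewrite Cmod_R, Rabs_pos_eq by apply Rlt_le, cbin_pos. reflexivity.
Qed.

(** For k > N one has |a + k| >= k - |a| >= (k+1)/2, so the k-th term is at most twice that of
    [is_series_cbin_succ]. The finitely many terms dropped include any with a zero denominator. *)
Lemma ex_Cseries_binom_term a : ex_Cseries (binom_term a).
Proof.
destruct (nfloor_ex (2 * Cmod a + 2)) as [N [_ HN]]; [pose proof (Cmod_ge_0 a); lra|].
apply (ex_series_incr_n (K := C_AbsRing) (V := C_NormedModule)) with (n := S N).
apply (ex_series_le (K := C_AbsRing) (V := C_CompleteNormedModule)) with
  (b := fun k => 2 * (cbin (S N + k) / INR (S (S N + k)))).
- intros k. change (Cmod (binom_term a (S N + k)) <= 2 * (cbin (S N + k) / INR (S (S N + k)))).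
  set (m := (S N + k)%nat).
  assert (Hm : INR N + 1 <= INR m) by (unfold m; rewrite <- S_INR; apply le_INR; lia).
  pose proof (Cmod_INR_ge a m). pose proof (Cmod_ge_0 a). pose proof (cbin_pos m).
  rewrite Cmod_binom_term by lra. rewrite S_INR.
  apply Rle_trans with (cbin m / ((INR m + 1) / 2)).
  + apply Rmult_le_compat_l; [lra|]. apply Rinv_le_contravar; lra.
  + apply Req_le. field. lra.
- apply (ex_series_scal (V := R_NormedModule)).
  apply (ex_series_incr_n (fun k => cbin k / INR (S k)) (S N)).
  exists 2. apply is_series_cbin_succ.
Qed.

(** The F of the overview. For Re a > 0 it equals Euler's beta integral B(a, 1/2), as expanding
    (1-t)^(-1/2) shows; the series has a meaning for all a off the poles. *)
Definition beta_sum (a : C) : C := CSeries (binom_term a).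

Lemma is_Cseries_beta_sum a : is_Cseries (binom_term a) (beta_sum a).
Proof. apply CSeries_correct, ex_Cseries_binom_term. Qed.

Lemma Clim_inv_INR (a : C) : Clim (fun n => / (a + RtoC (INR n)))%C (RtoC 0).
Proof.
destruct (nfloor_ex (Cmod a)) as [N [_ HN]]; [apply Cmod_ge_0|].
apply Clim_dominated with (v := fun n => / (INR n - Cmod a)).
- exists (S N). intros n Hn. apply le_INR in Hn. rewrite S_INR in Hn.
  pose proof (Cmod_INR_ge a n).
  replace (/ (a + INR n) - 0)%C with (/ (a + INR n))%C by ring.
  rewrite Cmod_inv by (apply Cmod_gt_0; lra). apply Rinv_le_contravar; lra.
- exact (is_lim_seq_inv_INR_plus (- Cmod a)).
Qed.

Lemma Csum_n_0 (a : nat -> C) : Csum_n a 0 = a O :> C.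
Proof. apply (sum_O (G := C_AbelianMonoid)). Qed.

Lemma Csum_n_S (a : nat -> C) n : Csum_n a (S n) = (Csum_n a n + a (S n))%C :> C.
Proof. apply (sum_Sn (G := C_AbelianMonoid)). Qed.

Lemma Csum_n_mult_l (c : C) (a : nat -> C) n : Csum_n (fun k => c * a k)%C n = (c * Csum_n a n)%C :> C.
Proof.
induction n as [|n IH]; [now rewrite !Csum_n_0|].
rewrite !Csum_n_S, IH. ring.
Qed.

Lemma Csum_n_minus (a b : nat -> C) n :
  Csum_n (fun k => a k - b k)%C n = (Csum_n a n - Csum_n b n)%C :> C.
Proof.
induction n as [|n IH]; [now rewrite !Csum_n_0|].
rewrite !Csum_n_S, IH. ring.
Qed.

Definition off_poles (a : C) : Prop := forall k : nat, (a + RtoC (INR k))%C <> RtoC 0.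

(* Telescoping: the difference of the k-th terms is t (k+1) - t k with t k = k c_k / (a + k). *)
Lemma beta_sum_succ a : off_poles a ->
  (a * beta_sum a = (a + RtoC (1 / 2)) * beta_sum (a + RtoC 1))%C.
Proof.
intros Ha.
pose (t := fun k => (RtoC (INR k) * RtoC (cbin k) * / (a + RtoC (INR k)))%C).
assert (St : forall n, Csum_n (fun k => a * binom_term a k
   - (a + RtoC (1 / 2)) * binom_term (a + RtoC 1) k)%C n = t (S n) :> C).
{ assert (step : forall k, (a * binom_term a k
     - (a + RtoC (1 / 2)) * binom_term (a + RtoC 1) k = t (S k) - t k)%C).
  { intros k. unfold t. rewrite !binom_term_cbin.
    rewrite <- (RtoC_mult (INR (S k))), (Rmult_comm (INR (S k))), cbin_S, RtoC_mult, RtoC_plus.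
    pose proof (Ha k) as H1. pose proof (Ha (S k)) as H2. rewrite S_INR, RtoC_plus in *.
    rewrite RtoC_div, RtoC_inv by lra.
    field. split; auto. }
  intros n. induction n as [|n IH].
  - rewrite Csum_n_0, step. unfold t at 2. simpl. ring.
  - rewrite Csum_n_S, IH, step. ring. }
assert (L0 : Clim (fun n => t (S n)) (RtoC 0)).
{ apply Clim_incr_1.
  apply (Clim_ext (fun n => RtoC (cbin n) - RtoC (cbin n) * a * / (a + RtoC (INR n)))%C).
  - intros n. unfold t. pose proof (Ha n). field. auto.
  - replace (RtoC 0) with (RtoC 0 - RtoC 0 * a * RtoC 0)%C by ring.
    assert (Clim (fun n => RtoC (cbin n)) (RtoC 0)) by apply Clim_RtoC, cbin_lim.
    apply Clim_minus; auto. apply Clim_mult; [|apply Clim_inv_INR].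
    apply Clim_mult; auto using Clim_const. }
assert (L1 : Clim (fun n => t (S n)) (a * beta_sum a
   - (a + RtoC (1 / 2)) * beta_sum (a + RtoC 1))%C).
{ apply (Clim_ext _ _ _ (St)).
  apply (Clim_ext (fun n => a * Csum_n (binom_term a) n - (a + RtoC (1 / 2)) * Csum_n (binom_term (a + RtoC 1)) n)%C).
  - intros n. now rewrite Csum_n_minus, !Csum_n_mult_l.
  - apply Clim_minus; (apply Clim_mult; [apply Clim_const|apply is_Cseries_Clim, is_Cseries_beta_sum]). }
apply Ceq_minus. now apply (Clim_unique _ _ _ L1).
Qed.

Lemma pochhammer_add a m n :
  pochhammer a (m + n) = (pochhammer a m * pochhammer (a + RtoC (INR m)) n)%C.
Proof.
induction n as [|n IH].
- rewrite Nat.add_0_r. simpl. ring.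
- rewrite Nat.add_succ_r. simpl. rewrite IH, plus_INR, RtoC_plus. ring.
Qed.

Lemma pochhammer_neq_0 a n : off_poles a -> pochhammer a n <> RtoC 0.
Proof.
intros H. induction n as [|n IH]; simpl; [apply RtoC_neq_0; lra|].
now apply Cmult_neq_0.
Qed.

Lemma beta_sum_shift a n : off_poles a ->
  (pochhammer a n * beta_sum a
   = pochhammer (a + RtoC (1 / 2)) n * beta_sum (a + RtoC (INR n)))%C.
Proof.
intros Ha. induction n as [|n IH].
- simpl. replace (a + RtoC 0)%C with a by ring. ring.
- simpl pochhammer.
  replace (pochhammer a n * (a + RtoC (INR n)) * beta_sum a)%C with
    ((a + RtoC (INR n)) * (pochhammer a n * beta_sum a))%C by ring.
  rewrite IH.
  assert (Hn : off_poles (a + RtoC (INR n))%C).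
  { intros k. specialize (Ha (n + k)%nat). rewrite plus_INR, RtoC_plus in Ha.
    intros E; apply Ha; rewrite <- E; ring. }
  pose proof (beta_sum_succ _ Hn) as E.
  replace (a + RtoC (INR (S n)))%C with (a + RtoC (INR n) + RtoC 1)%C
    by (rewrite S_INR, RtoC_plus; ring).
  transitivity (pochhammer (a + RtoC (1 / 2)) n * ((a + INR n) * beta_sum (a + INR n)))%C; [ring|].
  rewrite E. ring.
Qed.

(** * Values of F at positive integers and its growth along a + n *)

Lemma off_poles_INR_S n : off_poles (RtoC (INR (S n))).
Proof.
intros k. rewrite <- RtoC_plus, <- plus_INR. apply RtoC_neq_0, not_0_INR. lia.
Qed.

Lemma beta_sum_1 : beta_sum (RtoC 1) = RtoC 2.
Proof.
assert (E : forall k, binom_term (RtoC 1) k = RtoC (cbin k / INR (S k))).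
{ intros k. rewrite binom_term_cbin, <- RtoC_plus, Rplus_comm, <- S_INR, <- RtoC_inv, <- RtoC_mult;
    [reflexivity|apply not_0_INR; lia]. }
apply CSeries_unique, is_Cseries_Clim.
apply (Clim_ext (fun n => RtoC (sum_n (fun k => cbin k / INR (S k)) n))).
- intros n. apply C_eq; [rewrite Re_sum_n|rewrite Im_sum_n].
  + apply sum_n_ext. intros k. now rewrite E.
  + rewrite (sum_n_ext (fun k => Im (binom_term (RtoC 1) k)) (fun _ => 0)) by (intros k; now rewrite E).
    rewrite sum_n_const. simpl. ring.
- apply Clim_RtoC, is_series_cbin_succ.
Qed.

(** Both sides satisfy s F(s) = (s + 1/2) F(s+1) for s = n+1 and equal 2 at n = 0. The formula
    itself comes from substituting t = sin^2 x in B(n+1, 1/2). *)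
Lemma beta_sum_INR_S n : beta_sum (RtoC (INR (S n))) = RtoC (2 * wallis (2 * n + 1)).
Proof.
induction n as [|n IH].
- simpl (2 * 0 + 1)%nat. rewrite wallis_1. change (INR 1) with 1. rewrite beta_sum_1. f_equal; ring.
- pose proof (beta_sum_succ _ (off_poles_INR_S n)) as E. rewrite IH in E.
  rewrite (S_INR (S n)), (RtoC_plus (INR (S n))).
  set (s := INR (S n)) in *.
  assert (Hs : s = INR n + 1) by apply S_INR. pose proof (pos_INR n).
  pose proof (wallis_SS (2 * n + 1)) as W.
  replace (2 * n + 1 + 2)%nat with (2 * S n + 1)%nat in W by lia.
  replace (INR (2 * S n + 1)) with (2 * (s + / 2)) in W
    by (rewrite plus_INR, mult_INR; fold s; simpl; field).
  replace (INR (2 * n + 1 + 1)) with (2 * s) in W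
    by (rewrite !plus_INR, mult_INR, Hs; simpl; field).
  assert (W' : wallis (2 * S n + 1) = s * wallis (2 * n + 1) / (s + / 2)).
  { apply (Rmult_eq_reg_l (2 * (s + / 2))); [rewrite W; field; lra|lra]. }
  rewrite W'.
  assert (Hne : (RtoC s + RtoC (1 / 2))%C <> RtoC 0)
    by (rewrite <- RtoC_plus; apply RtoC_neq_0; lra).
  transitivity (/ (RtoC s + RtoC (1 / 2)) * (RtoC s * RtoC (2 * wallis (2 * n + 1))))%C.
  + rewrite E. field. auto.
  + rewrite <- RtoC_plus, <- RtoC_inv, <- !RtoC_mult by lra. f_equal. field. lra.
Qed.

Lemma Clim_sqrt_beta_sum_S :
  Clim (fun n => RtoC (sqrt (INR n)) * beta_sum (RtoC (INR (S n))))%C (RtoC (sqrt PI)).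
Proof.
apply (Clim_ext (fun n => RtoC (sqrt (INR n) * (2 * wallis (2 * n + 1))))).
- intros n. now rewrite beta_sum_INR_S, RtoC_mult.
- apply Clim_RtoC, wallis_lim.
Qed.

Lemma Cmod_Csum_n_le a (b : nat -> R) n :
  (forall k, Cmod (a k) <= b k) -> Cmod (Csum_n a n) <= sum_n b n.
Proof.
intros H. induction n as [|n IH]; [rewrite !sum_O; auto|].
rewrite !sum_Sn. eapply Rle_trans; [apply Cmod_triangle|]. apply Rplus_le_compat; auto.
Qed.

Lemma Clim_Cmod u l : Clim u l -> is_lim_seq (fun n => Cmod (u n)) (Cmod l).
Proof.
intros [H1 H2]. unfold Cmod. simpl.
apply is_lim_seq_continuous; [apply continuity_pt_sqrt; fold (Re l) (Im l); nra|].
apply is_lim_seq_plus'; repeat apply is_lim_seq_mult'; auto; apply is_lim_seq_const.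
Qed.

(** The k-th terms differ by (1-a) c_k / ((a+n+k)(n+1+k)), and |a+n+k| >= n - |a|. Hence each
    difference is at most a fixed multiple of the k-th term of F(n+1), which is positive, so the
    bounds can be summed. The relative error is O(1/n), which survives multiplication by sqrt n
    F(n+1). *)
Lemma Cmod_beta_sum_sub a (n : nat) : Cmod a < INR n ->
  Cmod (beta_sum (a + RtoC (INR n)) - beta_sum (RtoC (INR (S n))))
    <= Cmod (1 - a) / (INR n - Cmod a) * Cmod (beta_sum (RtoC (INR (S n)))).
Proof.
intros Hn.
pose proof (Cmod_ge_0 a) as Ha.
pose (b := fun k => Cmod (1 - a) / (INR n - Cmod a) * Re (binom_term (RtoC (INR (S n))) k)).
assert (Hterm : forall k, Cmod (binom_term (a + RtoC (INR n)) k - binom_term (RtoC (INR (S n))) k) <= b k).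
{ intros k. rewrite !binom_term_cbin.
  pose proof (Cmod_INR_ge a (n + k)) as H1. rewrite plus_INR, RtoC_plus, Cplus_assoc in H1.
  pose proof (pos_INR k) as Hk.
  assert (Hd : (a + INR n + INR k)%C <> 0) by (apply Cmod_gt_0; lra).
  unfold b. rewrite binom_term_cbin.
  assert (Hp : 0 < INR (S n) + INR k) by (rewrite S_INR; lra).
  rewrite <- RtoC_plus.
  rewrite <- RtoC_inv, <- RtoC_mult, re_RtoC by lra.
  replace (cbin k * / (a + INR n + INR k) - (cbin k * / (INR (S n) + INR k))%R)%C
    with ((1 - a) * / (a + INR n + INR k) * RtoC (cbin k * / (INR (S n) + INR k)))%C.
  - rewrite !Cmod_mult, Cmod_inv, Cmod_R by auto.
    rewrite (Rabs_pos_eq (cbin k * / (INR (S n) + INR k)))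
      by (apply Rlt_le, Rmult_lt_0_compat; [apply cbin_pos|now apply Rinv_0_lt_compat]).
    apply Rmult_le_compat_r; [apply Rlt_le, Rmult_lt_0_compat; [apply cbin_pos|now apply Rinv_0_lt_compat]|].
    apply Rmult_le_compat_l; [apply Cmod_ge_0|]. apply Rinv_le_contravar; lra.
  - rewrite RtoC_mult, RtoC_inv, RtoC_plus, S_INR, RtoC_plus by lra. field. split; auto.
    rewrite <- !RtoC_plus. apply RtoC_neq_0. rewrite S_INR in Hp. lra. }
assert (L1 : Clim (Csum_n (fun k => binom_term (a + RtoC (INR n)) k - binom_term (RtoC (INR (S n))) k)%C)
   (beta_sum (a + RtoC (INR n)) - beta_sum (RtoC (INR (S n))))).
{ apply (Clim_ext (fun m => Csum_n (binom_term (a + RtoC (INR n))) m - Csum_n (binom_term (RtoC (INR (S n)))) m)%C).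
  - intros m. now rewrite Csum_n_minus.
  - apply Clim_minus; apply is_Cseries_Clim, is_Cseries_beta_sum. }
apply Clim_Cmod in L1.
assert (L2 : is_lim_seq (sum_n b) (Cmod (1 - a) / (INR n - Cmod a) * Re (beta_sum (RtoC (INR (S n)))))).
{ apply (is_series_scal (V := R_NormedModule)).
  apply (is_Cseries_Re_Im (binom_term (RtoC (INR (S n)))) (beta_sum (RtoC (INR (S n))))), is_Cseries_beta_sum. }
apply Rle_trans with (Cmod (1 - a) / (INR n - Cmod a) * Re (beta_sum (RtoC (INR (S n))))).
- apply (is_lim_seq_le _ _ (Finite _) (Finite _)) with (2 := L1) (3 := L2).
  intros m. now apply Cmod_Csum_n_le.
- apply Rmult_le_compat_l; [apply Rmult_le_pos; [apply Cmod_ge_0|apply Rlt_le, Rinv_0_lt_compat; lra]|].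
  eapply Rle_trans; [apply Rle_abs|apply Rabs_Re_le].
Qed.

Lemma Clim_sqrt_beta_sum a :
  Clim (fun n => RtoC (sqrt (INR n)) * beta_sum (a + RtoC (INR n)))%C (RtoC (sqrt PI)).
Proof.
pose (D := fun n => (RtoC (sqrt (INR n)) * (beta_sum (a + RtoC (INR n)) - beta_sum (RtoC (INR (S n)))))%C).
assert (LD : Clim D (RtoC 0)).
{ destruct (nfloor_ex (Cmod a)) as [N [_ HN]]; [apply Cmod_ge_0|].
  apply Clim_dominated with (v := fun n => Cmod (1 - a) * / (INR n - Cmod a)
     * Cmod (RtoC (sqrt (INR n)) * beta_sum (RtoC (INR (S n))))).
  - exists (S N). intros n Hn. apply le_INR in Hn. rewrite S_INR in Hn.
    replace (D n - 0)%C with (D n) by ring. unfold D. rewrite !Cmod_mult.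
    pose proof (Cmod_beta_sum_sub a n). pose proof (Cmod_ge_0 (sqrt (INR n))).
    replace (Cmod (1 - a) * / (INR n - Cmod a)
     * (Cmod (RtoC (sqrt (INR n))) * Cmod (beta_sum (RtoC (INR (S n))))))
     with (Cmod (RtoC (sqrt (INR n))) * (Cmod (1 - a) / (INR n - Cmod a) * Cmod (beta_sum (RtoC (INR (S n)))))) by (unfold Rdiv; ring).
    apply Rmult_le_compat_l; auto. apply H. lra.
  - replace (Finite 0) with (Finite (Cmod (1 - a) * 0 * Cmod (RtoC (sqrt PI)))) by (f_equal; ring).
    apply is_lim_seq_mult'; [|apply Clim_Cmod, Clim_sqrt_beta_sum_S].
    apply is_lim_seq_mult'; [apply is_lim_seq_const|].
    exact (is_lim_seq_inv_INR_plus (- Cmod a)). }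
apply (Clim_ext (fun n => D n + RtoC (sqrt (INR n)) * beta_sum (RtoC (INR (S n))))%C).
- intros n. unfold D. ring.
- replace (RtoC (sqrt PI)) with (RtoC 0 + RtoC (sqrt PI))%C by ring.
  apply Clim_plus; [apply LD|apply Clim_sqrt_beta_sum_S].
Qed.

(** * The case alpha = 0 *)

Lemma CV_radius_cbin : CV_radius cbin = 1.
Proof.
replace (Finite 1) with (Finite (/ 1)) by (f_equal; field).
apply CV_radius_finite_DAlembert; [|lra|].
- intros n. apply Rgt_not_eq, cbin_pos.
- apply (is_lim_seq_ext (fun n => 1 - / 2 * / (INR n + 1))).
  + intros n. pose proof (cbin_pos n). pose proof (cbin_pos (S n)). pose proof (cbin_S n) as E.
    pose proof (pos_INR n). rewrite S_INR in E.
    rewrite Rabs_pos_eq by (apply Rlt_le, Rdiv_lt_0_compat; lra).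
    replace (cbin (S n)) with ((INR n + / 2) * cbin n / (INR n + 1)) by (rewrite <- E; field; lra).
    field. lra.
  + replace (Finite 1) with (Finite (1 - / 2 * 0)) by (f_equal; ring).
    apply is_lim_seq_minus'; [apply is_lim_seq_const|].
    apply is_lim_seq_mult'; [apply is_lim_seq_const|].
    apply is_lim_seq_inv_INR_plus.
Qed.

(** The recurrence (k+1) c_(k+1) = (k + 1/2) c_k reads f' = x f' + f/2 for the generating function
    f. *)
Lemma PSeries_cbin_ode x : Rabs x < 1 ->
  (1 - x) * PSeries (PS_derive cbin) x = / 2 * PSeries cbin x.
Proof.
intros Hx.
assert (Hc : Rbar_lt (Rabs x) (CV_radius cbin)) by (rewrite CV_radius_cbin; exact Hx).
assert (E : PSeries (PS_derive cbin) x
   = PSeries (PS_plus (PS_incr_1 (PS_derive cbin)) (PS_scal (/ 2) cbin)) x).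
{ apply PSeries_ext. intros n. unfold PS_derive, PS_plus, PS_scal, PS_incr_1.
  rewrite Rmult_comm, cbin_S.
  destruct n as [|n]; unfold plus, scal, zero; simpl; unfold mult; simpl; ring. }
assert (H0 : ex_pseries cbin x) by now apply CV_radius_inside.
assert (H1 : ex_pseries (PS_derive cbin) x)
  by (apply CV_radius_inside; now rewrite CV_radius_derive).
rewrite PSeries_plus, PSeries_incr_1, PSeries_scal in E.
- lra.
- now apply ex_pseries_incr_1.
- apply ex_pseries_scal; auto. apply Rmult_comm.
Qed.

(** By the differential equation, f(t) sqrt(1-t) has derivative zero on [0, x]; x = 0 is separate
    because [eq_is_derive] asks for a nondegenerate interval. *)
Lemma PSeries_cbin x : 0 <= x < 1 -> PSeries cbin x = / sqrt (1 - x).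
Proof.
intros Hx.
destruct (Req_dec x 0) as [->|Hx0].
{ rewrite PSeries_0, cbin_0, Rminus_0_r, sqrt_1. field. }
assert (E : PSeries cbin 0 * sqrt (1 - 0) = PSeries cbin x * sqrt (1 - x)).
{ apply (eq_is_derive (V := R_NormedModule) (fun t => PSeries cbin t * sqrt (1 - t))); [|lra].
  intros t Ht.
  assert (Habs : Rabs t < 1) by (rewrite Rabs_pos_eq; lra).
  assert (Hs : 0 < sqrt (1 - t)) by (apply sqrt_lt_R0; lra).
  pose proof (PSeries_cbin_ode t Habs) as O.
  assert (Hd := is_derive_PSeries cbin t ltac:(rewrite CV_radius_cbin; exact Habs)).
  assert (Hq : is_derive (fun t => sqrt (1 - t)) t (- (/ (2 * sqrt (1 - t))))).
  { auto_derive; [lra|]. fold (1 - t). field. lra. }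
  pose proof (is_derive_mult _ _ t _ _ Hd Hq Rmult_comm) as H.
  assert (Z : (@zero R_NormedModule : R) = plus (mult (PSeries (PS_derive cbin) t) (sqrt (1 - t)))
           (mult (PSeries cbin t) (- (/ (2 * sqrt (1 - t)))))); [|rewrite Z; exact H].
  change (0 = PSeries (PS_derive cbin) t * sqrt (1 - t) + PSeries cbin t * - / (2 * sqrt (1 - t))).
  apply (Rmult_eq_reg_r (sqrt (1 - t))); [|lra].
  transitivity (PSeries (PS_derive cbin) t * (sqrt (1 - t) * sqrt (1 - t)) - / 2 * PSeries cbin t);
    [|field; lra].
  rewrite sqrt_sqrt by lra. lra. }
rewrite PSeries_0, cbin_0, Rminus_0_r, sqrt_1 in E.
assert (Hs : 0 < sqrt (1 - x)) by (apply sqrt_lt_R0; lra).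
apply (Rmult_eq_reg_r (sqrt (1 - x))); [|lra]. rewrite <- E. field. lra.
Qed.

(** Coefficients of the antiderivative of ((1-x)^(-1/2) - 1)/x that vanishes at 0; the constant
    coefficient 0 stands for the term k = 0, absent from the sum. *)
Definition cbin_div (k : nat) : R := match k with O => 0 | S j => cbin k / INR k end.

Lemma PS_derive_cbin_div n : PS_derive cbin_div n = PS_decr_1 cbin n.
Proof.
unfold PS_derive, PS_decr_1, cbin_div. field. apply not_0_INR. lia.
Qed.

Lemma CV_radius_cbin_div : CV_radius cbin_div = 1.
Proof.
rewrite <- CV_radius_derive, (CV_radius_ext _ (PS_decr_1 cbin)) by apply PS_derive_cbin_div.
rewrite CV_radius_decr_1. apply CV_radius_cbin.
Qed.

Lemma PSeries_cbin_div x : 0 <= x < 1 ->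
  PSeries cbin_div x = 2 * ln 2 - 2 * ln (1 + sqrt (1 - x)).
Proof.
intros Hx.
destruct (Req_dec x 0) as [->|Hx0].
{ rewrite PSeries_0, Rminus_0_r, sqrt_1. simpl. replace (1 + 1) with 2 by ring. ring. }
assert (E : PSeries cbin_div 0 + 2 * ln (1 + sqrt (1 - 0))
   = PSeries cbin_div x + 2 * ln (1 + sqrt (1 - x))).
{ apply (eq_is_derive (V := R_NormedModule) (fun t => PSeries cbin_div t + 2 * ln (1 + sqrt (1 - t)))); [|lra].
  intros t Ht.
  assert (Habs : Rabs t < 1) by (rewrite Rabs_pos_eq; lra).
  assert (Hs : 0 < sqrt (1 - t)) by (apply sqrt_lt_R0; lra).
  assert (Hd := is_derive_PSeries cbin_div t ltac:(rewrite CV_radius_cbin_div; exact Habs)).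
  assert (Hq : is_derive (fun t => 2 * ln (1 + sqrt (1 - t))) t
     (- / (sqrt (1 - t) * (1 + sqrt (1 - t))))).
  { auto_derive; [split; [lra|split; auto; fold (1 - t); lra]|]. fold (1 - t). field. lra. }
  pose proof (is_derive_plus _ _ t _ _ Hd Hq) as H.
  assert (Z : (@zero R_NormedModule : R) = plus (PSeries (PS_derive cbin_div) t)
     (- / (sqrt (1 - t) * (1 + sqrt (1 - t))))); [|rewrite Z; exact H].
  change (0 = PSeries (PS_derive cbin_div) t + - / (sqrt (1 - t) * (1 + sqrt (1 - t)))).
  rewrite (PSeries_ext _ _ t PS_derive_cbin_div).
  (* The derivative series is (f(t) - 1)/t, a formula that gives nothing at t = 0; there its value
     is read off as the coefficient c_1 = 1/2. *)
  destruct (Req_dec t 0) as [->|Ht0].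
  - rewrite PSeries_0, Rminus_0_r, sqrt_1. unfold PS_decr_1.
    pose proof (cbin_S 0) as E. rewrite cbin_0 in E. simpl in *. lra.
  - assert (D := PSeries_decr_1 cbin t
      ltac:(apply CV_radius_inside; rewrite CV_radius_cbin; exact Habs)).
    rewrite PSeries_cbin, cbin_0 in D by lra.
    apply (Rmult_eq_reg_l t); [|lra].
    rewrite Rmult_plus_distr_l. replace (t * PSeries (PS_decr_1 cbin) t) with (/ sqrt (1 - t) - 1) by lra.
    (* With s = sqrt(1-t), the factorization t = (1-s)(1+s) turns (1/s - 1)/t into 1/(s(1+s)). *)
    assert (St : t = (1 - sqrt (1 - t)) * (1 + sqrt (1 - t)))
      by (ring_simplify; rewrite pow2_sqrt; lra).
    set (s := sqrt (1 - t)) in *. rewrite St. field. lra. }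
rewrite PSeries_0, Rminus_0_r, sqrt_1 in E. simpl in E. replace (1 + 1) with 2 in E by ring. lra.
Qed.

Lemma sum_n_mono_nonneg (a : nat -> R) n m : (forall k, 0 <= a k) -> (n <= m)%nat -> sum_n a n <= sum_n a m.
Proof.
intros Ha. induction 1 as [|m Hm IH]; [lra|].
rewrite sum_Sn. eapply Rle_trans; [apply IH|]. change (sum_n a m <= sum_n a m + a (S m)). specialize (Ha (S m)). lra.
Qed.

Lemma cbin_div_nonneg k : 0 <= cbin_div k.
Proof.
destruct k as [|k]; [simpl; lra|]. unfold cbin_div.
apply Rlt_le, Rdiv_lt_0_compat; [apply cbin_pos|]. apply lt_0_INR; lia.
Qed.

Lemma lim_PSeries_cbin_div : is_lim_seq (fun n => PSeries cbin_div (1 - / (INR n + 1))) (2 * ln 2).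
Proof.
apply (is_lim_seq_ext (fun n => 2 * ln 2 - 2 * ln (1 + sqrt (1 - (1 - / (INR n + 1)))))).
- intros n. pose proof (pos_INR n).
  assert (0 < / (INR n + 1) <= 1).
  { split; [apply Rinv_0_lt_compat; lra|]. rewrite <- Rinv_1. apply Rinv_le_contravar; lra. }
  rewrite PSeries_cbin_div by lra. reflexivity.
- replace (Finite (2 * ln 2)) with (Finite (2 * ln 2 - 2 * ln (1 + sqrt 0)))
    by (f_equal; rewrite sqrt_0, Rplus_0_r, ln_1; ring).
  apply is_lim_seq_continuous with (f := fun x => 2 * ln 2 - 2 * ln (1 + sqrt x))
     (u := fun n => 1 - (1 - / (INR n + 1))).
  + apply continuity_pt_minus; [apply continuity_pt_const; intros ? ?; auto|].
    apply continuity_pt_mult; [apply continuity_pt_const; intros ? ?; auto|].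
    apply continuity_pt_comp with (f1 := fun x => 1 + sqrt x) (f2 := ln).
    * apply continuity_pt_plus; [apply continuity_pt_const; intros ? ?; auto|].
      apply continuity_pt_sqrt; lra.
    * rewrite sqrt_0. apply derivable_continuous_pt. exists (/ (1 + 0)). apply derivable_pt_lim_ln. lra.
  + apply (is_lim_seq_ext (fun n => / (INR n + 1))); [intros; ring|].
    apply is_lim_seq_inv_INR_plus.
Qed.

(* Abel's theorem for nonnegative coefficients: each partial sum at 1 is a limit of partial sums
   at x < 1, hence at most the limit of the power series. *)
Lemma is_series_cbin_div : is_series cbin_div (2 * ln 2).
Proof.
assert (Hx : forall n, 0 <= 1 - / (INR n + 1) < 1).
{ intros n. pose proof (pos_INR n).
  assert (0 < / (INR n + 1) <= 1); [|lra].
  split; [apply Rinv_0_lt_compat; lra|]. rewrite <- Rinv_1. apply Rinv_le_contravar; lra. }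
assert (Lx : is_lim_seq (fun n => 1 - / (INR n + 1)) 1).
{ replace (Finite 1) with (Finite (1 - 0)) by (f_equal; ring).
  apply is_lim_seq_minus'; [apply is_lim_seq_const|].
  apply is_lim_seq_inv_INR_plus. }
assert (Hp : forall n, is_series (fun k => cbin_div k * (1 - / (INR n + 1)) ^ k) (PSeries cbin_div (1 - / (INR n + 1)))).
{ intros n. apply Series_correct.
  assert (H : ex_pseries cbin_div (1 - / (INR n + 1))).
  { apply CV_radius_inside. rewrite CV_radius_cbin_div. specialize (Hx n).
    simpl. rewrite Rabs_pos_eq; lra. }
  apply (ex_series_ext (V := R_NormedModule)) with (2 := H).
  intros k. unfold scal; simpl; unfold mult; simpl. rewrite pow_n_pow. ring. }
assert (Hpos : forall n k, 0 <= cbin_div k * (1 - / (INR n + 1)) ^ k).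
{ intros n k. apply Rmult_le_pos; [apply cbin_div_nonneg|]. apply pow_le, Hx. }
assert (U : forall N, sum_n cbin_div N <= 2 * ln 2).
{ intros N.
  assert (L : is_lim_seq (fun n => sum_n (fun k => cbin_div k * (1 - / (INR n + 1)) ^ k) N) (sum_n cbin_div N)).
  { induction N as [|N IH].
    - rewrite sum_O. apply (is_lim_seq_ext (fun _ => 0)); [intros; rewrite sum_O; simpl; ring|apply is_lim_seq_const].
    - rewrite sum_Sn.
      apply (is_lim_seq_ext (fun n => sum_n (fun k => cbin_div k * (1 - / (INR n + 1)) ^ k) N
        + cbin_div (S N) * (1 - / (INR n + 1)) ^ (S N))); [intros n; now rewrite sum_Sn|].
      apply is_lim_seq_plus'; [apply IH|].
      replace (cbin_div (S N)) with (cbin_div (S N) * 1 ^ S N) at 1 by (rewrite pow1; ring).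
      apply is_lim_seq_mult'; [apply is_lim_seq_const|].
      apply is_lim_seq_continuous with (f := fun x => x ^ S N); [|exact Lx].
      apply derivable_continuous_pt, derivable_pt_pow. }
  apply (is_lim_seq_le _ _ (Finite _) (Finite _)) with (2 := L) (3 := lim_PSeries_cbin_div).
  intros n.
  apply (is_lim_seq_le_loc (fun _ => sum_n (fun k => cbin_div k * (1 - / (INR n + 1)) ^ k) N)
    (sum_n (fun k => cbin_div k * (1 - / (INR n + 1)) ^ k)) (Finite _) (Finite _)).
  - exists N. intros m Hm. apply sum_n_mono_nonneg; auto.
  - apply is_lim_seq_const.
  - apply Hp. }
destruct (ex_finite_lim_seq_incr (sum_n cbin_div) (2 * ln 2)) as [l Hl]; auto.
{ intros n. apply sum_n_mono_nonneg; [apply cbin_div_nonneg|lia]. }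
replace (2 * ln 2) with l; [exact Hl|].
apply Rle_antisym.
- apply (is_lim_seq_le _ _ (Finite _) (Finite _)) with (1 := U) (2 := Hl). apply is_lim_seq_const.
(* Conversely x^k <= 1 bounds the power series at each x < 1 by the sum l at 1, and the limit x -> 1
   gives 2 ln 2 <= l. *)
- apply (is_lim_seq_le (fun n => PSeries cbin_div (1 - / (INR n + 1))) (fun _ => l) (Finite _) (Finite _));
    [|apply lim_PSeries_cbin_div|apply is_lim_seq_const].
  intros n.
  apply (is_lim_seq_le (sum_n (fun k => cbin_div k * (1 - / (INR n + 1)) ^ k)) (sum_n cbin_div)
     (Finite _) (Finite _)); [|apply Hp|exact Hl].
  intros m. apply sum_n_m_le. intros k.
  rewrite <- (Rmult_1_r (cbin_div k)) at 2. apply Rmult_le_compat_l; [apply cbin_div_nonneg|].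
  apply Rle_trans with (1 ^ k); [apply pow_incr; specialize (Hx n); lra|rewrite pow1; lra].
Qed.

(** * Improper integrals over the positive half-line *)

Definition is_RInt_pos (f : R -> R) (l : R) : Prop :=
  is_RInt_gen f (at_right 0) (Rbar_locally p_infty) l.

Definition continuous_pos (f : R -> R) : Prop := forall t, 0 < t -> continuous f t.

(** Lets a property known for all t > 0 be used where the improper integral asks for it on
    eventually all intervals, and lets such an interval be taken to contain a given one. *)
Lemma filter_prod_pos (a b : R) : 0 < a ->
  filter_prod (at_right 0) (Rbar_locally p_infty)
    (fun ab : R * R => 0 < fst ab < a /\ b < snd ab).
Proof.
intros Ha. apply (Filter_prod _ _ _ (fun x => 0 < x < a) (fun y => b < y)).
- exists (mkposreal a Ha). intros y Hy H0. split; [exact H0|].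
  apply Rabs_lt_between in Hy. unfold minus, plus, opp in Hy; simpl in Hy. lra.
- exists b. auto.
- intros x y; auto.
Qed.

Lemma is_RInt_pos_ext f g l : (forall t, 0 < t -> f t = g t) -> is_RInt_pos f l -> is_RInt_pos g l.
Proof.
intros E. apply is_RInt_gen_ext. generalize (filter_prod_pos 1 1 Rlt_0_1).
apply filter_imp. intros [a b] [H1 H2] x Hx. simpl in *. apply E.
unfold Rmin in Hx. destruct (Rle_dec a b); lra.
Qed.

Lemma is_RInt_pos_plus f g l m : is_RInt_pos f l -> is_RInt_pos g m -> is_RInt_pos (fun t => f t + g t) (l + m).
Proof. exact (is_RInt_gen_plus f g l m). Qed.

Lemma is_RInt_pos_scal k f l : is_RInt_pos f l -> is_RInt_pos (fun t => k * f t) (k * l).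
Proof. exact (is_RInt_gen_scal f k l). Qed.

Lemma is_RInt_pos_minus f g l m : is_RInt_pos f l -> is_RInt_pos g m -> is_RInt_pos (fun t => f t - g t) (l - m).
Proof. exact (is_RInt_gen_minus f g l m). Qed.

Lemma is_RInt_pos_unique f l : is_RInt_pos f l -> RInt_gen f (at_right 0) (Rbar_locally p_infty) = l.
Proof. exact (is_RInt_gen_unique (V := R_CompleteNormedModule) f l). Qed.

Lemma is_RInt_pos_abs_le f g l m : (forall t, 0 < t -> Rabs (f t) <= g t) ->
  is_RInt_pos f l -> is_RInt_pos g m -> Rabs l <= m.
Proof.
intros H Hf Hg. refine (RInt_gen_norm (V := R_CompleteNormedModule) f g l m _ _ Hf Hg).
- generalize (filter_prod_pos 1 1 Rlt_0_1). apply filter_imp. intros [a b] [H1 H2]; simpl in *; lra.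
- generalize (filter_prod_pos 1 1 Rlt_0_1). apply filter_imp. intros [a b] [H1 H2] x Hx; simpl in *.
  apply H; lra.
Qed.

Lemma is_RInt_pos_derive F f la lb : (forall t, 0 < t -> is_derive F t (f t)) -> continuous_pos f ->
  filterlim F (at_right 0) (locally la) -> filterlim F (Rbar_locally p_infty) (locally lb) ->
  is_RInt_pos f (lb - la).
Proof.
intros HF Hf Ha Hb.
apply (is_RInt_pos_ext (Derive F)); [intros t Ht; now apply is_derive_unique, HF|].
refine (is_RInt_gen_Derive F la lb _ _ Ha Hb); generalize (filter_prod_pos 1 1 Rlt_0_1);
  apply filter_imp; intros [a b] [H1 H2] x Hx; simpl in *;
  assert (H0 : 0 < x) by (unfold Rmin in Hx; destruct (Rle_dec a b); lra).
- exists (f x); auto.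
- apply (continuous_ext_loc (T := R_UniformSpace) (U := R_UniformSpace) (Derive F) f x); auto.
  exists (mkposreal x H0). intros y Hy. symmetry. apply is_derive_unique, HF.
  apply Rabs_lt_between in Hy. unfold minus, plus, opp in Hy; simpl in Hy. lra.
Qed.

Lemma continuous_pos_ex_RInt f a b : continuous_pos f -> 0 < a -> a <= b -> ex_RInt f a b.
Proof.
intros Hf Ha Hab. apply (ex_RInt_continuous (V := R_CompleteNormedModule)).
intros z Hz. apply Hf. unfold Rmin in Hz. destruct (Rle_dec a b); lra.
Qed.

Lemma RInt_nonneg_mono f a a' b' b : continuous_pos f -> (forall t, 0 < t -> 0 <= f t) ->
  0 < a -> a <= a' -> a' <= b' -> b' <= b -> RInt f a' b' <= RInt f a b.
Proof.
intros Hf Hp H0 H1 H2 H3.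
rewrite <- (RInt_Chasles (V := R_CompleteNormedModule) f a a' b),
  <- (RInt_Chasles (V := R_CompleteNormedModule) f a' b' b);
  try (apply continuous_pos_ex_RInt; auto; lra).
assert (0 <= RInt f a a') by (apply RInt_ge_0; auto; [apply continuous_pos_ex_RInt; auto; lra|intros; apply Hp; lra]).
assert (0 <= RInt f b' b) by (apply RInt_ge_0; auto; [apply continuous_pos_ex_RInt; auto; lra|intros; apply Hp; lra]).
unfold plus; simpl. lra.
Qed.

(** For a nonnegative integrand the integral grows with the interval, so the supremum over compact
    subintervals is the limit. *)
Lemma ex_is_RInt_pos_nonneg f M : continuous_pos f -> (forall t, 0 < t -> 0 <= f t) ->
  (forall a b, 0 < a -> a <= b -> RInt f a b <= M) -> exists l, is_RInt_pos f l.
Proof.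
intros Hf Hp HM.
destruct (completeness (fun x => exists a b, 0 < a /\ a <= b /\ x = RInt f a b)) as [L [HL1 HL2]].
- exists M. intros x (a & b & H1 & H2 & ->). auto.
- exists (RInt f 1 1), 1, 1. repeat split; lra.
- exists L. intros P [eps HP].
  assert (E : exists a b, 0 < a /\ a <= b /\ L - eps < RInt f a b).
  { destruct (Classical_Prop.classic (exists a b, 0 < a /\ a <= b /\ L - eps < RInt f a b)) as [H|H]; auto.
    exfalso. assert (L <= L - eps); [|destruct eps; simpl in *; lra].
    apply HL2. intros x (a & b & H1 & H2 & ->). apply Rnot_lt_le. intros H3. apply H.
    exists a, b; auto. }
  destruct E as (a0 & b0 & Ha0 & Hab0 & HLe).
  unfold filtermapi. generalize (filter_prod_pos a0 b0 Ha0). apply filter_imp. intros [a b] [H1 H2]; simpl in *.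
  exists (RInt f a b). split.
  + apply (RInt_correct (V := R_CompleteNormedModule)), continuous_pos_ex_RInt; auto; lra.
  + apply HP. apply Rabs_lt_between. unfold minus, plus, opp; simpl.
    assert (RInt f a b <= L) by (apply HL1; exists a, b; repeat split; lra).
    pose proof (RInt_nonneg_mono f a a0 b0 b Hf Hp). destruct eps; simpl in *. lra.
Qed.

Lemma is_RInt_pos_RInt_le f l a b : continuous_pos f -> (forall t, 0 < t -> 0 <= f t) ->
  is_RInt_pos f l -> 0 < a -> a <= b -> RInt f a b <= l.
Proof.
intros Hf Hp H Ha Hab. apply Rnot_lt_le. intros Hlt.
assert (He : 0 < RInt f a b - l) by lra.
specialize (H _ (locally_ball l (mkposreal _ He))).
unfold filtermapi in H.
generalize (filter_and _ _ H (filter_prod_pos a b Ha)). intros H'.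
destruct (filter_ex _ H') as [[a' b'] [(y & Hy1 & Hy2) [H1 H2]]]. simpl in *.
apply (is_RInt_unique (V := R_CompleteNormedModule)) in Hy1.
pose proof (RInt_nonneg_mono f a' a b b' Hf Hp).
apply Rabs_lt_between in Hy2. unfold minus, plus, opp in Hy2; simpl in Hy2. lra.
Qed.

(** The function f + g lies between 0 and 2g, so the nonnegative criterion applies to it;
    subtracting g recovers f. *)
Lemma ex_is_RInt_pos_dominated f g l : continuous_pos f -> continuous_pos g ->
  (forall t, 0 < t -> Rabs (f t) <= g t) -> is_RInt_pos g l -> exists m, is_RInt_pos f m.
Proof.
intros Hf Hg H Hl.
assert (Hg0 : forall t, 0 < t -> 0 <= g t)
  by (intros t Ht; eapply Rle_trans; [apply Rabs_pos|apply H, Ht]).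
destruct (ex_is_RInt_pos_nonneg (fun t => f t + g t) (2 * l)) as [m Hm].
- intros t Ht. apply (continuous_plus (V := R_NormedModule) f g t); auto.
- intros t Ht. specialize (H t Ht). apply Rabs_le_between in H. lra.
- intros a b Ha Hab.
  assert (Eg := continuous_pos_ex_RInt g a b Hg Ha Hab).
  assert (Ef := continuous_pos_ex_RInt f a b Hf Ha Hab).
  apply Rle_trans with (RInt (fun t => 2 * g t) a b).
  + apply RInt_le; auto.
    * now apply (ex_RInt_plus (V := R_NormedModule)).
    * now apply (ex_RInt_scal (V := R_NormedModule)).
    * intros x Hx. specialize (H x ltac:(lra)). apply Rabs_le_between in H. lra.
  + rewrite (RInt_scal (V := R_CompleteNormedModule) g) by auto.
    apply Rmult_le_compat_l; [lra|]. now apply is_RInt_pos_RInt_le.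
- exists (m - l). apply (is_RInt_pos_ext (fun t => f t + g t - g t)); [intros; ring|].
  now apply is_RInt_pos_minus.
Qed.

Lemma exp_INR_ln n t : 0 < t -> exp (INR n * ln t) = t ^ n.
Proof. intros Ht. rewrite <- Rpower_pow by auto. reflexivity. Qed.

Lemma filterlim_at_right_continuous (f : R -> R) (x : R) :
  continuous f x -> filterlim f (at_right x) (locally (f x)).
Proof. intros H. eapply filterlim_filter_le_1; [apply filter_le_within|exact H]. Qed.

Lemma filterlim_pow_exp_0 x : 0 < x ->
  filterlim (fun t => exp (x * ln t) * exp (- t)) (at_right 0) (locally 0).
Proof.
intros Hx.
assert (K : filterlim (fun y => x * y) (Rbar_locally m_infty) (Rbar_locally m_infty)).
{ assert (K : is_lim (fun y => x * y) m_infty (Rbar_mult x m_infty))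
    by exact (is_lim_scal_l (fun y => y) x m_infty m_infty (is_lim_id m_infty)).
  replace (Rbar_mult x m_infty) with m_infty in K; [exact K|].
  symmetry. apply is_Rbar_mult_unique, is_Rbar_mult_sym, is_Rbar_mult_m_infty_pos, Hx. }
assert (H : filterlim (fun t => exp (x * ln t)) (at_right 0) (locally 0)).
{ refine (filterlim_comp _ _ _ (fun t => x * ln t) exp (at_right 0) (Rbar_locally m_infty) _ _ is_lim_exp_m).
  exact (filterlim_comp _ _ _ ln (fun y => x * y) (at_right 0) _ _ is_lim_ln_0 K). }
replace (locally 0) with (locally (mult (0 : R_AbsRing) (exp (- 0))))
  by (f_equal; apply Rmult_0_l).
refine (filterlim_comp_2 (fun t => exp (x * ln t)) (fun t => exp (- t)) Rmult H _ (filterlim_mult (K := R_AbsRing) 0 (exp (- 0)))).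
apply (filterlim_at_right_continuous (fun t => exp (- t))).
apply (ex_derive_continuous (fun t => exp (- t))). auto_derive; auto.
Qed.

(** The exponent x ln t - t is t (x ln t / t - 1), and the second factor tends to -1, whatever the
    sign of x. *)
Lemma filterlim_pow_exp_p x :
  filterlim (fun t => exp (x * ln t) * exp (- t)) (Rbar_locally p_infty) (locally 0).
Proof.
apply (is_lim_ext_loc (fun t => exp (t * (x * (ln t / t) - 1))) _ p_infty 0).
- exists 0. intros t Ht. rewrite <- exp_plus. f_equal. field. lra.
- refine (filterlim_comp _ _ _ (fun t => t * (x * (ln t / t) - 1)) exp (Rbar_locally p_infty)
    (Rbar_locally m_infty) _ _ is_lim_exp_m).
  assert (L : is_lim (fun t => x * (ln t / t) - 1) p_infty (x * 0 - 1)).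
  { apply (is_lim_minus' (fun t => x * (ln t / t)) (fun _ => 1) p_infty (x * 0) 1);
      [|apply is_lim_const].
    exact (is_lim_scal_l (fun t => ln t / t) x p_infty 0 is_lim_div_ln_p). }
  rewrite Rmult_0_r, Rminus_0_l in L.
  assert (K : is_Rbar_mult p_infty (- (1)) m_infty) by (apply is_Rbar_mult_p_infty_neg; simpl; lra).
  assert (H := is_lim_mult (fun t => t) _ p_infty p_infty _ (is_lim_id p_infty) L).
  rewrite (is_Rbar_mult_unique _ _ _ K) in H. apply H.
  simpl. lra.
Qed.

(** Integration by parts: t^(n+1) e^(-t) vanishes at both ends, so its derivative integrates to 0.
    Powers in the antiderivative are written with [exp] and [ln] to fit the boundary limits
    above. *)
Lemma is_RInt_pos_pow_exp n : is_RInt_pos (fun t => t ^ n * exp (- t)) (INR (fact n)).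
Proof.
induction n as [|n IH].
- replace (INR (fact 0)) with (0 - (-1)) by (simpl; ring).
  apply (is_RInt_pos_derive (fun t => - exp (- t))).
  + intros t Ht. auto_derive; auto. ring.
  + intros t Ht. apply (ex_derive_continuous (fun t => t ^ 0 * exp (- t))). auto_derive; auto.
  + replace (-1) with (- exp (- 0)) by (rewrite Ropp_0, exp_0; ring).
    apply (filterlim_at_right_continuous (fun t => - exp (- t))).
    apply (ex_derive_continuous (fun t => - exp (- t))). auto_derive; auto.
  + pose proof (filterlim_pow_exp_p 0) as H.
    replace 0 with (- 0) by ring.
    apply (is_lim_opp (fun t => exp (- t)) p_infty 0).
    apply (is_lim_ext (fun t => exp (0 * ln t) * exp (- t))); [|exact H].
    intros y. rewrite Rmult_0_l, exp_0. ring.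
- assert (H : is_RInt_pos (fun t => INR (S n) * (t ^ n * exp (- t)) - t ^ S n * exp (- t)) (0 - 0)).
  { apply (is_RInt_pos_derive (fun t => exp (INR (S n) * ln t) * exp (- t))).
    - intros t Ht.
      assert (D : forall k, is_derive (fun t => exp (k * ln t) * exp (- t)) t
        (k * / t * exp (k * ln t) * exp (- t) - exp (k * ln t) * exp (- t)))
        by (intros k; auto_derive; auto; ring).
      specialize (D (INR (S n))). rewrite exp_INR_ln in D by auto.
      replace (INR (S n) * (t ^ n * exp (- t)) - t ^ S n * exp (- t)) with
        (INR (S n) * / t * t ^ S n * exp (- t) - t ^ S n * exp (- t)); [exact D|].
      rewrite <- tech_pow_Rmult. field. lra.
    - intros t Ht. apply (ex_derive_continuous (fun t => INR (S n) * (t ^ n * exp (- t)) - t ^ S n * exp (- t))).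
      auto_derive; auto.
    - apply filterlim_pow_exp_0, lt_0_INR; lia.
    - apply filterlim_pow_exp_p. }
  replace (INR (fact (S n))) with (INR (S n) * INR (fact n) - (0 - 0))
    by (rewrite fact_simpl, mult_INR; ring).
  apply (is_RInt_pos_ext (fun t => INR (S n) * (t ^ n * exp (- t))
    - (INR (S n) * (t ^ n * exp (- t)) - t ^ S n * exp (- t)))); [intros; ring|].
  apply is_RInt_pos_minus; auto. now apply is_RInt_pos_scal.
Qed.

(** * Asymptotics of Gamma *)

(** Records convergence together with the value; [RInt_gen] alone, being total, carries no
    convergence. *)
Definition is_Gamma (z l : C) : Prop :=
  is_RInt_pos (fun t => Re (Gamma_integrand z t)) (Re l) /\
  is_RInt_pos (fun t => Im (Gamma_integrand z t)) (Im l).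

Lemma is_Gamma_unique z l : is_Gamma z l -> Gamma_integral z = l.
Proof. intros [H1 H2]. apply C_eq; now apply is_RInt_pos_unique. Qed.

Lemma Re_Gamma_integrand z t :
  Re (Gamma_integrand z t) = exp ((Re z - 1) * ln t) * cos (Im z * ln t) * exp (- t).
Proof.
destruct z as [x y]. unfold Gamma_integrand, Rpow_C, Cexp, Re, Im. simpl.
replace ((x + - (1)) * ln t - (y + - 0) * 0) with ((x - 1) * ln t) by ring.
replace ((x + - (1)) * 0 + (y + - 0) * ln t) with (y * ln t) by ring. ring.
Qed.

Lemma Im_Gamma_integrand z t :
  Im (Gamma_integrand z t) = exp ((Re z - 1) * ln t) * sin (Im z * ln t) * exp (- t).
Proof.
destruct z as [x y]. unfold Gamma_integrand, Rpow_C, Cexp, Re, Im. simpl.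
replace ((x + - (1)) * ln t - (y + - 0) * 0) with ((x - 1) * ln t) by ring.
replace ((x + - (1)) * 0 + (y + - 0) * ln t) with (y * ln t) by ring. ring.
Qed.

Lemma exp_pred_ln x t : 0 < t -> exp ((x - 1) * ln t) = exp (x * ln t) / t.
Proof.
intros Ht. rewrite Rmult_minus_distr_r, Rmult_1_l.
unfold Rminus. rewrite exp_plus, exp_Ropp, exp_ln by auto. reflexivity.
Qed.

Lemma filterlim_bounded_mul_0 {F : (R -> Prop) -> Prop} {FF : Filter F} (f g : R -> R) :
  (forall t, Rabs (g t) <= 1) -> filterlim f F (locally 0) ->
  filterlim (fun t => f t * g t) F (locally 0).
Proof.
intros Hg Hf. apply filterlim_locally. intros eps.
generalize (proj1 (filterlim_locally _ _) Hf eps). apply filter_imp.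
intros t Ht. change (Rabs (f t * g t - 0) < eps). change (Rabs (f t - 0) < eps) in Ht.
rewrite Rminus_0_r in *. rewrite Rabs_mult. specialize (Hg t).
pose proof (Rabs_pos (f t)). nra.
Qed.

Lemma Rabs_cos_le_1 x : Rabs (cos x) <= 1.
Proof. apply Rabs_le, COS_bound. Qed.

Lemma Rabs_sin_le_1 x : Rabs (sin x) <= 1.
Proof. apply Rabs_le, SIN_bound. Qed.

(** Integration by parts read downwards: convergence at z is a conclusion here. This covers 0 < Re z
    < 1, where the integrand is unbounded near 0 and the polynomial majorants used for Re z >= 1
    fail. *)
Lemma is_Gamma_of_succ z l : 0 < Re z -> is_Gamma (z + RtoC 1) l -> is_Gamma z (l / z)%C.
Proof.
intros Hz [HA HB].
set (x := Re z) in *. set (y := Im z).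
assert (E1 : forall t, 0 < t -> Re (Gamma_integrand z t) = exp (x * ln t) / t * cos (y * ln t) * exp (- t))
  by (intros t Ht; rewrite Re_Gamma_integrand, exp_pred_ln; auto).
assert (E2 : forall t, 0 < t -> Im (Gamma_integrand z t) = exp (x * ln t) / t * sin (y * ln t) * exp (- t))
  by (intros t Ht; rewrite Im_Gamma_integrand, exp_pred_ln; auto).
assert (E3 : forall t, Re (Gamma_integrand (z + RtoC 1) t) = exp (x * ln t) * cos (y * ln t) * exp (- t)).
{ intros t. rewrite Re_Gamma_integrand, re_plus, im_plus, re_RtoC, im_RtoC.
  fold x y. replace (x + 1 - 1) with x by ring. now rewrite Rplus_0_r. }
assert (E4 : forall t, Im (Gamma_integrand (z + RtoC 1) t) = exp (x * ln t) * sin (y * ln t) * exp (- t)).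
{ intros t. rewrite Im_Gamma_integrand, re_plus, im_plus, re_RtoC, im_RtoC.
  fold x y. replace (x + 1 - 1) with x by ring. now rewrite Rplus_0_r. }
(* [P1] and [P2] are the real and imaginary parts of the derivative of t^z e^(-t), namely z t^(z-1)
   e^(-t) - t^z e^(-t). *)
assert (P1 : is_RInt_pos (fun t => (x * (exp (x * ln t) / t * cos (y * ln t) * exp (- t))
     - y * (exp (x * ln t) / t * sin (y * ln t) * exp (- t)))
     - exp (x * ln t) * cos (y * ln t) * exp (- t)) (0 - 0)).
{ apply (is_RInt_pos_derive (fun t => exp (x * ln t) * exp (- t) * cos (y * ln t))).
  - intros t Ht. auto_derive; auto. field. lra.
  - intros t Ht. apply (ex_derive_continuous (fun t => (x * (exp (x * ln t) / t * cos (y * ln t) * exp (- t))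
     - y * (exp (x * ln t) / t * sin (y * ln t) * exp (- t)))
     - exp (x * ln t) * cos (y * ln t) * exp (- t))). auto_derive; repeat split; auto; lra.
  - apply (filterlim_bounded_mul_0 (fun t => exp (x * ln t) * exp (- t)) (fun t => cos (y * ln t)));
      [intros; apply Rabs_cos_le_1|now apply filterlim_pow_exp_0].
  - apply (filterlim_bounded_mul_0 (fun t => exp (x * ln t) * exp (- t)) (fun t => cos (y * ln t)));
      [intros; apply Rabs_cos_le_1|now apply filterlim_pow_exp_p]. }
assert (P2 : is_RInt_pos (fun t => (x * (exp (x * ln t) / t * sin (y * ln t) * exp (- t))
     + y * (exp (x * ln t) / t * cos (y * ln t) * exp (- t)))
     - exp (x * ln t) * sin (y * ln t) * exp (- t)) (0 - 0)).
{ apply (is_RInt_pos_derive (fun t => exp (x * ln t) * exp (- t) * sin (y * ln t))).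
  - intros t Ht. auto_derive; auto. field. lra.
  - intros t Ht. apply (ex_derive_continuous (fun t => (x * (exp (x * ln t) / t * sin (y * ln t) * exp (- t))
     + y * (exp (x * ln t) / t * cos (y * ln t) * exp (- t)))
     - exp (x * ln t) * sin (y * ln t) * exp (- t))). auto_derive; repeat split; auto; lra.
  - apply (filterlim_bounded_mul_0 (fun t => exp (x * ln t) * exp (- t)) (fun t => sin (y * ln t)));
      [intros; apply Rabs_sin_le_1|now apply filterlim_pow_exp_0].
  - apply (filterlim_bounded_mul_0 (fun t => exp (x * ln t) * exp (- t)) (fun t => sin (y * ln t)));
      [intros; apply Rabs_sin_le_1|now apply filterlim_pow_exp_p]. }
apply (is_RInt_pos_ext _ _ _ (fun t _ => E3 t)) in HA.
apply (is_RInt_pos_ext _ _ _ (fun t _ => E4 t)) in HB.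
assert (Q1 := is_RInt_pos_plus _ _ _ _ P1 HA). assert (Q2 := is_RInt_pos_plus _ _ _ _ P2 HB).
(* Adding the integrals at z+1 leaves z I = l for the integral I sought; it is solved by multiplying
   with the conjugate of z over |z|^2, on the integrands and on the values alike. *)
assert (Hd : x * x + y * y <> 0) by nra.
assert (Hl : Re (l / z)%C = (x * Re l + y * Im l) / (x * x + y * y) /\
   Im (l / z)%C = (x * Im l - y * Re l) / (x * x + y * y)).
{ unfold x, y in *. destruct l as [a b], z as [p q]. simpl in *. split; field; nra. }
destruct Hl as [Hl1 Hl2]. split.
- rewrite Hl1.
  apply (is_RInt_pos_ext (fun t => / (x * x + y * y) * (x * ((x * (exp (x * ln t) / t * cos (y * ln t) * exp (- t))
     - y * (exp (x * ln t) / t * sin (y * ln t) * exp (- t)))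
     - exp (x * ln t) * cos (y * ln t) * exp (- t) + exp (x * ln t) * cos (y * ln t) * exp (- t))
     + y * ((x * (exp (x * ln t) / t * sin (y * ln t) * exp (- t))
     + y * (exp (x * ln t) / t * cos (y * ln t) * exp (- t)))
     - exp (x * ln t) * sin (y * ln t) * exp (- t) + exp (x * ln t) * sin (y * ln t) * exp (- t))))).
  { intros t Ht. rewrite E1 by auto. field. lra. }
  replace ((x * Re l + y * Im l) / (x * x + y * y)) with
    (/ (x * x + y * y) * (x * (0 - 0 + Re l) + y * (0 - 0 + Im l))) by (field; auto).
  apply is_RInt_pos_scal, is_RInt_pos_plus; now apply is_RInt_pos_scal.
- rewrite Hl2.
  apply (is_RInt_pos_ext (fun t => / (x * x + y * y) * (x * ((x * (exp (x * ln t) / t * sin (y * ln t) * exp (- t))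
     + y * (exp (x * ln t) / t * cos (y * ln t) * exp (- t)))
     - exp (x * ln t) * sin (y * ln t) * exp (- t) + exp (x * ln t) * sin (y * ln t) * exp (- t))
     - y * ((x * (exp (x * ln t) / t * cos (y * ln t) * exp (- t))
     - y * (exp (x * ln t) / t * sin (y * ln t) * exp (- t)))
     - exp (x * ln t) * cos (y * ln t) * exp (- t) + exp (x * ln t) * cos (y * ln t) * exp (- t))))).
  { intros t Ht. rewrite E2 by auto. field. lra. }
  replace ((x * Im l - y * Re l) / (x * x + y * y)) with
    (/ (x * x + y * y) * (x * (0 - 0 + Im l) - y * (0 - 0 + Re l))) by (field; auto).
  apply is_RInt_pos_scal, is_RInt_pos_minus; now apply is_RInt_pos_scal.
Qed.

Lemma exp_nondecreasing a b : a <= b -> exp a <= exp b.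
Proof. intros [H| ->]; [now apply Rlt_le, exp_increasing|lra]. Qed.

Lemma exp_mul_ln_le x M t : 0 < t -> 0 <= x <= INR M -> exp (x * ln t) <= 1 + t ^ M.
Proof.
intros Ht Hx. pose proof (pow_lt t M Ht) as Hp. pose proof (exp_INR_ln M t Ht) as E.
destruct (Rle_lt_dec 1 t) as [H|H].
- assert (0 <= ln t) by (rewrite <- ln_1; apply ln_le; lra).
  assert (exp (x * ln t) <= exp (INR M * ln t)); [|lra].
  apply exp_nondecreasing. nra.
- assert (ln t < 0) by (rewrite <- ln_1; apply ln_increasing; lra).
  assert (exp (x * ln t) <= exp 0); [|rewrite exp_0 in *; lra].
  apply exp_nondecreasing. nra.
Qed.

(** With exponent Re z - 1 >= 0 the integrand is dominated by (1 + t^(M+1)) e^(-t), whose integral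
    is a sum of factorials. *)
Lemma ex_is_Gamma_ge_1 z : 1 <= Re z -> exists l, is_Gamma z l.
Proof.
intros Hz. destruct (nfloor_ex (Re z)) as [M [_ HM]]; [lra|].
set (x := Re z) in *. set (y := Im z).
pose (g := fun t => t ^ 0 * exp (- t) + t ^ S M * exp (- t)).
assert (Hg : is_RInt_pos g (INR (fact 0) + INR (fact (S M)))) by (apply is_RInt_pos_plus; apply is_RInt_pos_pow_exp).
assert (Cg : continuous_pos g).
{ intros t Ht. apply (ex_derive_continuous g). unfold g. auto_derive; auto. }
assert (B : forall c t, 0 < t -> Rabs c <= 1 -> Rabs (exp ((x - 1) * ln t) * c * exp (- t)) <= g t).
{ intros c t Ht Hc.
  assert (H : exp ((x - 1) * ln t) <= 1 + t ^ S M)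
    by (apply exp_mul_ln_le; auto; rewrite S_INR; lra).
  pose proof (exp_pos ((x - 1) * ln t)). pose proof (exp_pos (- t)).
  rewrite !Rabs_mult, (Rabs_pos_eq (exp ((x - 1) * ln t))), (Rabs_pos_eq (exp (- t))) by lra.
  replace (g t) with ((1 + t ^ S M) * exp (- t)) by (unfold g; simpl; ring).
  apply Rmult_le_compat_r; [lra|]. pose proof (Rabs_pos c). nra. }
destruct (ex_is_RInt_pos_dominated (fun t => exp ((x - 1) * ln t) * cos (y * ln t) * exp (- t)) g
   (INR (fact 0) + INR (fact (S M)))) as [a Ha]; auto.
{ intros t Ht. apply (ex_derive_continuous (fun t => exp ((x - 1) * ln t) * cos (y * ln t) * exp (- t))).
  auto_derive; auto. }
{ intros t Ht. apply B; auto. apply Rabs_cos_le_1. }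
destruct (ex_is_RInt_pos_dominated (fun t => exp ((x - 1) * ln t) * sin (y * ln t) * exp (- t)) g
   (INR (fact 0) + INR (fact (S M)))) as [b Hb]; auto.
{ intros t Ht. apply (ex_derive_continuous (fun t => exp ((x - 1) * ln t) * sin (y * ln t) * exp (- t))).
  auto_derive; auto. }
{ intros t Ht. apply B; auto. apply Rabs_sin_le_1. }
exists (a, b). split.
- apply is_RInt_pos_ext with (2 := Ha). intros; symmetry; apply Re_Gamma_integrand.
- apply is_RInt_pos_ext with (2 := Hb). intros; symmetry; apply Im_Gamma_integrand.
Qed.

Lemma is_Gamma_integral z : 0 < Re z -> is_Gamma z (Gamma_integral z).
Proof.
intros Hz. destruct (ex_is_Gamma_ge_1 (z + RtoC 1)) as [l Hl].
- rewrite re_plus, re_RtoC. lra.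
- apply is_Gamma_of_succ in Hl; auto. now rewrite (is_Gamma_unique _ _ Hl).
Qed.

Lemma Gamma_integral_succ z : 0 < Re z ->
  Gamma_integral (z + RtoC 1) = (z * Gamma_integral z)%C.
Proof.
intros Hz.
assert (H : is_Gamma (z + RtoC 1) (Gamma_integral (z + RtoC 1)))
  by (apply is_Gamma_integral; rewrite re_plus, re_RtoC; lra).
apply is_Gamma_of_succ, is_Gamma_unique in H; auto. rewrite H. field.
intros E. rewrite E, re_RtoC in Hz. lra.
Qed.

Lemma Gamma_integral_shift z n : 0 < Re z ->
  Gamma_integral (z + RtoC (INR n)) = (pochhammer z n * Gamma_integral z)%C.
Proof.
intros Hz. induction n as [|n IH].
- simpl. replace (z + RtoC 0)%C with z by ring. ring.
- rewrite S_INR, RtoC_plus, Cplus_assoc, Gamma_integral_succ, IH.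
  + simpl. ring.
  + rewrite re_plus, re_RtoC. pose proof (pos_INR n). lra.
Qed.

Lemma Gamma_shift_spec z n : 0 < Re z + INR n -> (Gamma_shift z <= n)%nat.
Proof.
intros H. unfold Gamma_shift. destruct (archimed (- Re z)) as [H1 H2].
assert (Hlt : (up (- Re z) < Z.of_nat n + 1)%Z).
{ apply lt_IZR. rewrite plus_IZR, <- INR_IZR_INZ. lra. }
lia.
Qed.

Lemma Gamma_shift_pos z : 0 < Re z + INR (Gamma_shift z).
Proof.
unfold Gamma_shift. destruct (archimed (- Re z)) as [H1 H2].
rewrite INR_IZR_INZ.
assert (IZR (up (- Re z)) <= IZR (Z.of_nat (Z.to_nat (up (- Re z))))) by (apply IZR_le; lia).
lra.
Qed.

(** Replaces the particular shift N in the definition of [Gamma] by any sufficiently large n: the n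
    - N additional factors come from the functional equation of the integral. *)
Lemma Gamma_mul_pochhammer z n : off_poles z -> 0 < Re z + INR n ->
  (Gamma z * pochhammer z n = Gamma_integral (z + RtoC (INR n)))%C.
Proof.
intros Hz Hn. unfold Gamma. cbv zeta. set (N := Gamma_shift z).
assert (HN : (N <= n)%nat) by now apply Gamma_shift_spec.
replace n with (N + (n - N))%nat by lia.
rewrite pochhammer_add, plus_INR, RtoC_plus, Cplus_assoc, (Gamma_integral_shift (z + RtoC (INR N))%C).
- field. now apply pochhammer_neq_0.
- rewrite re_plus, re_RtoC. apply Gamma_shift_pos.
Qed.

(** * Concentration of the normalized Gamma density at 1 *)

Lemma MVT_bound_1 (f df : R -> R) (B s : R) : 0 < s ->
  (forall t, 0 < t -> is_derive f t (df t)) ->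
  (forall t, Rmin 1 s <= t <= Rmax 1 s -> Rabs (df t) <= B) ->
  Rabs (f s - f 1) <= B * Rabs (s - 1).
Proof.
intros Hs Hd Hb.
assert (Hm : 0 < Rmin 1 s) by (unfold Rmin; destruct (Rle_dec 1 s); lra).
destruct (MVT_gen f 1 s df) as [c [Hc E]].
- intros t Ht. apply Hd. lra.
- intros t Ht. apply continuity_pt_filterlim, (ex_derive_continuous f).
  exists (df t). apply Hd. lra.
- rewrite E, Rabs_mult. apply Rmult_le_compat_r; [apply Rabs_pos|]. now apply Hb.
Qed.

Lemma exp_mul_ln_le_between x M s t : 0 < s -> 0 <= x <= INR M -> Rmin 1 s <= t <= Rmax 1 s ->
  exp (x * ln t) <= 1 + s ^ M.
Proof.
intros Hs Hx Ht. pose proof (pow_lt s M Hs).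
destruct (Rle_lt_dec 1 s) as [H1|H1].
- rewrite Rmin_left, Rmax_right in Ht by lra.
  apply Rle_trans with (exp (x * ln s)); [|now apply exp_mul_ln_le].
  apply exp_nondecreasing. apply Rmult_le_compat_l; [lra|]. apply ln_le; lra.
- rewrite Rmin_right, Rmax_left in Ht by lra.
  assert (ln t <= 0) by (rewrite <- ln_1; apply ln_le; lra).
  assert (exp (x * ln t) <= exp 0); [|rewrite exp_0 in *; lra].
  apply exp_nondecreasing. nra.
Qed.

(** The derivative of t^z is z t^(z-1), with |z| <= x + |y| and t^(x-1) <= 1 + s^M between 1 and s.
    The mean value theorem is applied to the two components separately, as it fails for complex
    values; x >= 1 keeps the exponent x - 1 nonnegative. *)
Lemma cpow_sub_1_bound x y M s : 0 < s -> 1 <= x <= INR M + 1 ->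
  Rabs (exp (x * ln s) * cos (y * ln s) - 1) <= (x + Rabs y) * (1 + s ^ M) * Rabs (s - 1) /\
  Rabs (exp (x * ln s) * sin (y * ln s)) <= (x + Rabs y) * (1 + s ^ M) * Rabs (s - 1).
Proof.
intros Hs Hx.
(* One bound for both derivatives: a and b are the parts of z up to sign, c and d a cosine and a
   sine in either order. *)
assert (B : forall a b c d t, Rmin 1 s <= t <= Rmax 1 s -> Rabs a <= x -> Rabs b <= Rabs y ->
   Rabs c <= 1 -> Rabs d <= 1 ->
   Rabs (exp ((x - 1) * ln t) * (a * c + b * d)) <= (x + Rabs y) * (1 + s ^ M)).
{ intros a b c d t Ht Ha Hb Hc Hd.
  rewrite Rabs_mult, (Rabs_pos_eq (exp _)) by apply Rlt_le, exp_pos.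
  rewrite (Rmult_comm (x + Rabs y)).
  apply Rmult_le_compat; [apply Rlt_le, exp_pos|apply Rabs_pos| |].
  - apply exp_mul_ln_le_between with (1 := Hs) (3 := Ht). lra.
  - eapply Rle_trans; [apply Rabs_triang|]. rewrite !Rabs_mult.
    pose proof (Rabs_pos a). pose proof (Rabs_pos b). pose proof (Rabs_pos c). pose proof (Rabs_pos d).
    nra. }
split.
- replace 1 with (exp (x * ln 1) * cos (y * ln 1)) at 1
    by (rewrite ln_1, !Rmult_0_r, exp_0, cos_0; ring).
  apply (MVT_bound_1 (fun t => exp (x * ln t) * cos (y * ln t))
    (fun t => exp ((x - 1) * ln t) * (x * cos (y * ln t) + (- y) * sin (y * ln t)))); auto.
  + intros t Ht. rewrite exp_pred_ln by auto. auto_derive; auto. field. lra.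
  + intros t Ht. apply B; auto using Rabs_cos_le_1, Rabs_sin_le_1.
    * rewrite Rabs_pos_eq; lra.
    * rewrite Rabs_Ropp; lra.
- replace (exp (x * ln s) * sin (y * ln s)) with
    (exp (x * ln s) * sin (y * ln s) - exp (x * ln 1) * sin (y * ln 1))
    by (rewrite ln_1, !Rmult_0_r, sin_0; ring).
  apply (MVT_bound_1 (fun t => exp (x * ln t) * sin (y * ln t))
    (fun t => exp ((x - 1) * ln t) * (x * sin (y * ln t) + y * cos (y * ln t)))); auto.
  + intros t Ht. rewrite exp_pred_ln by auto. auto_derive; auto. field. lra.
  + intros t Ht. apply B; auto using Rabs_cos_le_1, Rabs_sin_le_1.
    * rewrite Rabs_pos_eq; lra.
    * lra.
Qed.

(** The k-th moment of T/(m+1), where T has density t^m e^(-t)/m! and mean m+1. Thus m+1 is the n of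
    the overview. *)
Definition moment (m k : nat) : R := INR (fact (m + k)) / (INR (fact m) * INR (S m) ^ k).

Lemma is_RInt_pos_moment m k :
  is_RInt_pos (fun t => (t / INR (S m)) ^ k * (t ^ m * exp (- t))) (INR (fact m) * moment m k).
Proof.
assert (H0 : INR (S m) <> 0) by (apply not_0_INR; lia).
pose proof (INR_fact_neq_0 m).
assert (INR (S m) ^ k <> 0) by now apply pow_nonzero.
apply (is_RInt_pos_ext (fun t => / INR (S m) ^ k * (t ^ (m + k) * exp (- t)))).
- intros t Ht. unfold Rdiv. rewrite Rpow_mult_distr, pow_inv, pow_add. ring.
- replace (INR (fact m) * moment m k) with (/ INR (S m) ^ k * INR (fact (m + k)))
    by (unfold moment; field; auto).
  apply is_RInt_pos_scal, is_RInt_pos_pow_exp.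
Qed.

Lemma moment_lim k : is_lim_seq (fun m => moment m k) 1.
Proof.
induction k as [|k IH].
- apply (is_lim_seq_ext (fun _ => 1)); [|apply is_lim_seq_const].
  intros m. unfold moment. rewrite Nat.add_0_r. pose proof (INR_fact_neq_0 m). simpl. field. auto.
- apply (is_lim_seq_ext (fun m => moment m k * (1 + INR k * / INR (S m)))).
  + intros m. unfold moment. replace (m + S k)%nat with (S (m + k)) by lia.
    assert (H0 : INR (S m) <> 0) by (apply not_0_INR; lia).
    pose proof (INR_fact_neq_0 m). assert (INR (S m) ^ k <> 0) by now apply pow_nonzero.
    rewrite fact_simpl, mult_INR, <- tech_pow_Rmult.
    replace (INR (S (m + k))) with (INR (S m) + INR k) by (rewrite <- plus_INR; f_equal; lia).
    field. auto.
  + replace (Finite 1) with (Finite (1 * (1 + INR k * 0))) by (f_equal; ring).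
    apply is_lim_seq_mult'; auto. apply is_lim_seq_plus'; [apply is_lim_seq_const|].
    apply is_lim_seq_mult'; [apply is_lim_seq_const|].
    apply (is_lim_seq_ext (fun m => / (INR m + 1))); [intros; now rewrite S_INR|].
    apply is_lim_seq_inv_INR_plus.
Qed.

(* [|u| <= (e + u^2 / e) / 2] turns [|t/N - 1| (1 + (t/N)^M)] into a combination of moments. *)
Definition moment_bound (K eps : R) (M m : nat) : R :=
  K / 2 * (eps * (moment m 0 + moment m M)
    + / eps * ((moment m 2 - 2 * moment m 1 + moment m 0)
        + (moment m (M + 2) - 2 * moment m (M + 1) + moment m M))).

(** The terms carrying 1/eps are the means of (u-1)^2 and u^M (u-1)^2 for u = T/(m+1); both tend to
    1 - 2 + 1 = 0, which leaves K/2 times 2 eps. *)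
Lemma moment_bound_lim K eps M : is_lim_seq (moment_bound K eps M) (K * eps).
Proof.
unfold moment_bound.
replace (Finite (K * eps)) with
  (Finite (K / 2 * (eps * (1 + 1) + / eps * ((1 - 2 * 1 + 1) + (1 - 2 * 1 + 1)))))
  by (f_equal; replace (1 - 2 * 1 + 1) with 0 by ring; rewrite Rplus_0_r, Rmult_0_r; field).
repeat first [ apply is_lim_seq_minus' | apply is_lim_seq_plus' | apply moment_lim
  | apply is_lim_seq_mult'; [apply is_lim_seq_const|] ].
Qed.

(** Applied to the components of ((t/n)^z - 1) t^m e^(-t) with n = m+1; the hypothesis on f is what
    [cpow_sub_1_bound] provides. *)
Lemma is_RInt_pos_sub_fact_bound f l x y M m eps : 0 < eps -> 1 <= x <= INR M + 1 ->
  (forall t, 0 < t -> Rabs (f t) <=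
     (x + Rabs y) * (1 + (t / INR (S m)) ^ M) * Rabs (t / INR (S m) - 1) * (t ^ m * exp (- t))) ->
  is_RInt_pos f l -> Rabs (l / INR (fact m)) <= moment_bound (x + Rabs y) eps M m.
Proof.
intros He Hx Hf Hl.
set (K := x + Rabs y) in *.
assert (HK : 0 <= K) by (unfold K; pose proof (Rabs_pos y); lra).
pose (mm := fun k t => (t / INR (S m)) ^ k * (t ^ m * exp (- t))).
assert (Hm : forall k, is_RInt_pos (mm k) (INR (fact m) * moment m k)) by (intros k; exact (is_RInt_pos_moment m k)).
(* The integral of u^k (u-1)^2 against the weight, expanded into three moments. *)
assert (Hq : forall k, is_RInt_pos _ _) by (intros k; exact (is_RInt_pos_plus _ _ _ _
  (is_RInt_pos_minus _ _ _ _ (Hm (k + 2)%nat) (is_RInt_pos_scal 2 _ _ (Hm (k + 1)%nat))) (Hm k))).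
assert (HG := is_RInt_pos_scal (K / 2) _ _ (is_RInt_pos_plus _ _ _ _
  (is_RInt_pos_scal eps _ _ (is_RInt_pos_plus _ _ _ _ (Hm 0%nat) (Hm M)))
  (is_RInt_pos_scal (/ eps) _ _ (is_RInt_pos_plus _ _ _ _ (Hq 0%nat) (Hq M))))).
cbv beta in HG. simpl Nat.add in HG.
assert (Hfact : 0 < INR (fact m)) by apply INR_fact_lt_0.
unfold Rdiv. rewrite Rabs_mult, Rabs_inv, (Rabs_pos_eq (INR (fact m))) by lra.
apply (Rmult_le_reg_r (INR (fact m))); auto.
rewrite Rmult_assoc, Rinv_l, Rmult_1_r by lra.
eapply Rle_trans; [refine (is_RInt_pos_abs_le f _ l _ _ Hl HG)|
  apply Req_le; unfold moment_bound; ring].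
intros t Ht. eapply Rle_trans; [apply Hf, Ht|].
set (u := t / INR (S m)) in *.
assert (Hu : 0 < u) by (apply Rdiv_lt_0_compat; auto; apply lt_0_INR; lia).
pose proof (pow_lt u M Hu) as HuM.
assert (Hw : 0 < t ^ m * exp (- t)) by (apply Rmult_lt_0_compat; [now apply pow_lt|apply exp_pos]).
unfold mm. fold u.
rewrite !pow_add.
replace (K / 2 *
 (eps * (u ^ 0 * (t ^ m * exp (- t)) + u ^ M * (t ^ m * exp (- t))) +
  / eps *
  (u ^ 2 * (t ^ m * exp (- t)) - 2 * (u ^ 1 * (t ^ m * exp (- t))) + u ^ 0 * (t ^ m * exp (- t)) +
   (u ^ M * u ^ 2 * (t ^ m * exp (- t)) - 2 * (u ^ M * u ^ 1 * (t ^ m * exp (- t))) +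
    u ^ M * (t ^ m * exp (- t))))))
  with (K * (1 + u ^ M) * ((eps + / eps * (u - 1) ^ 2) / 2) * (t ^ m * exp (- t))) by (simpl; field; lra).
apply Rmult_le_compat_r; [lra|].
apply Rmult_le_compat_l; [apply Rmult_le_pos; lra|].
rewrite <- (pow2_abs (u - 1)). set (v := Rabs (u - 1)).
apply (Rmult_le_reg_l eps); auto.
replace (eps * ((eps + / eps * v ^ 2) / 2)) with ((eps * eps + v ^ 2) / 2) by (field; lra).
pose proof (pow2_ge_0 (eps - v)). nra.
Qed.

(** With n = m+1 this is n^(-z) t^(z+n-1) e^(-t) = (t/n)^z t^m e^(-t): the exponent n - 1 is exactly
    m, so the weight of the moments appears. *)
Lemma Rpow_C_mul_Gamma_integrand z m t : 0 < t ->
  (Rpow_C (INR (S m)) (- z) * Gamma_integrand (z + RtoC (INR (S m))) t)%C =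
  (exp (Re z * ln (t / INR (S m))) * cos (Im z * ln (t / INR (S m))) * (t ^ m * exp (- t)),
   exp (Re z * ln (t / INR (S m))) * sin (Im z * ln (t / INR (S m))) * (t ^ m * exp (- t))).
Proof.
intros Ht.
assert (HN : 0 < INR (S m)) by (apply lt_0_INR; lia).
rewrite (ln_div t (INR (S m))), <- (exp_INR_ln m t) by auto.
assert (E : INR m = INR (S m) - 1) by (rewrite S_INR; ring). rewrite E.
unfold Gamma_integrand, Rpow_C, Cexp. destruct z as [x y]. unfold Re, Im.
set (N := INR (S m)) in *. cbn [fst snd Cmult Cplus Copp Cminus RtoC].
replace (- x * ln N - - y * 0) with (- (x * ln N)) by ring.
replace (- x * 0 + - y * ln N) with (- (y * ln N)) by ring.
replace ((x + N + - (1)) * ln t - (y + 0 + - 0) * 0) with (x * ln t + (N - 1) * ln t) by ring.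
replace ((x + N + - (1)) * 0 + (y + 0 + - 0) * ln t) with (y * ln t) by ring.
replace (x * (ln t - ln N)) with (- (x * ln N) + x * ln t) by ring.
replace (y * (ln t - ln N)) with (y * ln t - y * ln N) by ring.
rewrite !exp_plus, cos_neg, sin_neg, cos_minus, sin_minus.
apply C_eq; simpl; ring.
Qed.

(** For fixed eps the bound does not tend to 0, only to K eps; n goes to infinity first, then eps to
    0. *)
Lemma is_lim_seq_of_bounds (u : nat -> R) (l K : R) (b : R -> nat -> R) : 0 < K ->
  (forall eps, 0 < eps -> is_lim_seq (b eps) (K * eps)) ->
  (forall eps n, 0 < eps -> Rabs (u n - l) <= b eps n) -> is_lim_seq u l.
Proof.
intros HK Hb H. apply is_lim_seq_spec. intros d.
(* This makes K e = d/2, and the bound is eventually within d/2 of that. *)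
pose (e := d / (2 * K)).
assert (He : 0 < e) by (apply Rdiv_lt_0_compat; [apply cond_pos|lra]).
pose proof (proj2 (is_lim_seq_spec _ _) (Hb e He)) as Hl.
assert (Hd : 0 < d / 2) by (pose proof (cond_pos d); lra).
specialize (Hl (mkposreal _ Hd)). generalize Hl. apply filter_imp. intros n Hn. simpl in Hn.
specialize (H e n He). apply Rabs_lt_between in Hn.
replace (K * e) with (d / 2) in Hn by (unfold e; field; lra). lra.
Qed.

Lemma Clim_Gamma_integral z : 1 <= Re z ->
  Clim (fun m => Rpow_C (INR (S m)) (- z) * Gamma_integral (z + RtoC (INR (S m))) / RtoC (INR (fact m)))%C
    (RtoC 1).
Proof.
intros Hz.
destruct (nfloor_ex (Re z)) as [M [_ HM]]; [lra|].
assert (HK : 0 < Re z + Rabs (Im z)) by (pose proof (Rabs_pos (Im z)); lra).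
pose (k := fun m => Rpow_C (INR (S m)) (- z)).
pose (A := fun m => (k m * Gamma_integral (z + RtoC (INR (S m))))%C).
assert (HA : forall m, is_RInt_pos (fun t => Re (k m * Gamma_integrand (z + RtoC (INR (S m))) t)%C) (Re (A m)) /\
   is_RInt_pos (fun t => Im (k m * Gamma_integrand (z + RtoC (INR (S m))) t)%C) (Im (A m))).
{ intros m. destruct (is_Gamma_integral (z + RtoC (INR (S m)))) as [H1 H2].
  - rewrite re_plus, re_RtoC. pose proof (pos_INR (S m)). lra.
  - unfold A. rewrite re_mult, im_mult. split.
    + apply (is_RInt_pos_ext (fun t => Re (k m) * Re (Gamma_integrand (z + RtoC (INR (S m))) t)
        - Im (k m) * Im (Gamma_integrand (z + RtoC (INR (S m))) t))); [intros; now rewrite re_mult|].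
      apply is_RInt_pos_minus; now apply is_RInt_pos_scal.
    + apply (is_RInt_pos_ext (fun t => Re (k m) * Im (Gamma_integrand (z + RtoC (INR (S m))) t)
        + Im (k m) * Re (Gamma_integrand (z + RtoC (INR (S m))) t))); [intros; now rewrite im_mult|].
      apply is_RInt_pos_plus; now apply is_RInt_pos_scal. }
assert (Hu : forall m t, 0 < t -> 0 < t / INR (S m))
  by (intros; apply Rdiv_lt_0_compat; auto; apply lt_0_INR; lia).
assert (Hw : forall m t, 0 < t -> 0 < t ^ m * exp (- t))
  by (intros; apply Rmult_lt_0_compat; [now apply pow_lt|apply exp_pos]).
assert (HM' : 1 <= Re z <= INR M + 1) by lra.
apply (Clim_ext (fun m => RtoC (/ INR (fact m)) * A m)%C).
{ intros m. rewrite RtoC_inv by apply INR_fact_neq_0. unfold A, k, Cdiv. ring. }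
split.
(* The real part is compared with t^m e^(-t), whose integral m! becomes the limit 1 after division;
   the imaginary part is compared with 0. *)
- apply is_lim_seq_of_bounds with (b := fun eps => moment_bound (Re z + Rabs (Im z)) eps M) (1 := HK);
    [intros; apply moment_bound_lim|].
  intros eps m He. rewrite re_scal_l, re_RtoC.
  replace (/ INR (fact m) * Re (A m) - 1) with ((Re (A m) - INR (fact m)) / INR (fact m))
    by (field; apply INR_fact_neq_0).
  apply is_RInt_pos_sub_fact_bound with (f := fun t => Re (k m * Gamma_integrand (z + RtoC (INR (S m))) t)%C
    - t ^ m * exp (- t)); auto.
  + intros t Ht. unfold k. rewrite Rpow_C_mul_Gamma_integrand by auto. unfold Re at 1. cbn [fst].
    destruct (cpow_sub_1_bound (Re z) (Im z) M (t / INR (S m)) (Hu m t Ht) HM') as [H _].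
    replace (exp (Re z * ln (t / INR (S m))) * cos (Im z * ln (t / INR (S m))) * (t ^ m * exp (- t)) - t ^ m * exp (- t))
      with ((exp (Re z * ln (t / INR (S m))) * cos (Im z * ln (t / INR (S m))) - 1) * (t ^ m * exp (- t))) by ring.
    rewrite Rabs_mult, (Rabs_pos_eq (t ^ m * exp (- t))) by apply Rlt_le, Hw, Ht.
    apply Rmult_le_compat_r; [apply Rlt_le, Hw, Ht|exact H].
  + exact (is_RInt_pos_minus _ _ _ _ (proj1 (HA m)) (is_RInt_pos_pow_exp m)).
- apply is_lim_seq_of_bounds with (b := fun eps => moment_bound (Re z + Rabs (Im z)) eps M) (1 := HK);
    [intros; apply moment_bound_lim|].
  intros eps m He. rewrite im_scal_l, im_RtoC, Rminus_0_r, Rmult_comm.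
  apply is_RInt_pos_sub_fact_bound with (f := fun t => Im (k m * Gamma_integrand (z + RtoC (INR (S m))) t)%C); auto.
  + intros t Ht. unfold k. rewrite Rpow_C_mul_Gamma_integrand by auto. unfold Im at 1. cbn [snd].
    destruct (cpow_sub_1_bound (Re z) (Im z) M (t / INR (S m)) (Hu m t Ht) HM') as [_ H].
    rewrite Rabs_mult, (Rabs_pos_eq (t ^ m * exp (- t))) by apply Rlt_le, Hw, Ht.
    apply Rmult_le_compat_r; [apply Rlt_le, Hw, Ht|exact H].
  + exact (proj2 (HA m)).
Qed.

(** * Evaluation *)

Lemma Cplus_sub_cancel_l (x y : C) : y = (x + y - x)%C.
Proof. ring. Qed.

(** Gauss's limit formula for Gamma. The auxiliary shift j brings Re (a + j) up to 1, as the
    integral asymptotics require, while a itself may lie anywhere off the poles. *)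
Lemma Clim_Gamma_pochhammer a (j : nat) : off_poles a -> 1 <= Re a + INR j ->
  Clim (fun m => Rpow_C (INR (S m)) (- (a + RtoC (INR j))) * (Gamma a * pochhammer a (j + S m))
     / RtoC (INR (fact m)))%C (RtoC 1).
Proof.
intros Ha Hj.
eapply Clim_ext; [|apply (Clim_Gamma_integral (a + RtoC (INR j)))].
- intros m. cbv beta. pose proof (pos_INR (S m)).
  rewrite Gamma_mul_pochhammer; auto.
  + now rewrite plus_INR, RtoC_plus, Cplus_assoc.
  + rewrite plus_INR. lra.
- now rewrite re_plus, re_RtoC.
Qed.

Lemma Gamma_neq_0 a : off_poles a -> Gamma a <> RtoC 0.
Proof.
intros Ha E. destruct (INR_unbounded (1 - Re a)) as [j Hj].
assert (H := Clim_Gamma_pochhammer a j Ha ltac:(lra)). rewrite E in H.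
apply (Clim_ext _ (fun _ => RtoC 0)) in H; [|intros; unfold Cdiv; ring].
assert (F := Clim_unique _ _ _ H (Clim_const _)). apply RtoC_inj in F. lra.
Qed.

Lemma Rpow_C_sub_half t z : 0 < t ->
  Rpow_C t (- z) = (RtoC (sqrt t) * Rpow_C t (- (z + RtoC (1 / 2))))%C.
Proof.
intros Ht. rewrite <- Rpower_sqrt by auto. unfold Rpower.
unfold Rpow_C, Cexp. destruct z as [x y]. unfold Re, Im.
cbn [fst snd Cmult Cplus Copp Cminus RtoC].
apply C_eq; unfold Re, Im; cbn [fst snd].
- replace (- x * ln t - - y * 0) with (/ 2 * ln t + (- (x + 1 / 2) * ln t - - (y + 0) * 0)) by field.
  replace (- x * 0 + - y * ln t) with (- (x + 1 / 2) * 0 + - (y + 0) * ln t) by ring.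
  rewrite exp_plus. simpl. ring.
- replace (- x * ln t - - y * 0) with (/ 2 * ln t + (- (x + 1 / 2) * ln t - - (y + 0) * 0)) by field.
  replace (- x * 0 + - y * ln t) with (- (x + 1 / 2) * 0 + - (y + 0) * ln t) by ring.
  rewrite exp_plus. simpl. ring.
Qed.

(** One sequence has two limits. Gauss's formula at a, times F(a) Gamma(b) with b = a + 1/2, tends
    to the left side. Gauss's formula at b, times Gamma(a) sqrt n F(a+j+n), tends to the right side.
    They agree term by term by [beta_sum_shift], the factor sqrt n making up for n^(-1/2) between
    the powers at a and at b. *)
Lemma beta_sum_mul_Gamma a : off_poles a -> off_poles (a + RtoC (1 / 2))%C ->
  (beta_sum a * Gamma (a + RtoC (1 / 2)) = RtoC (sqrt PI) * Gamma a)%C.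
Proof.
intros Ha Hb. destruct (INR_unbounded (1 - Re a)) as [j Hj].
set (b := (a + RtoC (1 / 2))%C) in *.
assert (Lu := Clim_Gamma_pochhammer a j Ha ltac:(lra)).
assert (Lv := Clim_Gamma_pochhammer b j Hb
  ltac:(unfold b; rewrite re_plus, re_RtoC; lra)).
(* Reindexed to n = m+1, to match the limits for Gamma. *)
assert (LF := proj2 (Clim_incr_1 _ _) (Clim_sqrt_beta_sum (a + RtoC (INR j)))).
cbv beta in LF.
assert (L1 := Clim_mult _ _ _ _ (Clim_const (beta_sum a * Gamma b)%C) Lu).
assert (L2 := Clim_mult _ _ _ _ (Clim_mult _ _ _ _ (Clim_const (Gamma a)) Lv) LF).
cbv beta in L1, L2.
rewrite Cmult_1_r in L1. rewrite Cmult_1_r in L2.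
rewrite (Cmult_comm (RtoC (sqrt PI))).
apply (Clim_unique _ _ _ L1). apply Clim_ext with (2 := L2).
intros m.
pose proof (beta_sum_shift a (j + S m) Ha) as E. fold b in E.
rewrite (Rpow_C_sub_half (INR (S m)) (a + RtoC (INR j))) by (apply lt_0_INR; lia).
replace (a + RtoC (INR j) + RtoC (1 / 2))%C with (b + RtoC (INR j))%C by (unfold b; ring).
replace (a + RtoC (INR j) + RtoC (INR (S m)))%C with (a + RtoC (INR (j + S m)))%C
  by (rewrite plus_INR, RtoC_plus; ring).
set (k := Rpow_C _ _). set (s := RtoC (sqrt _)). unfold Cdiv. set (f := (/ _)%C).
transitivity (Gamma a * Gamma b * k * f * s * (pochhammer b (j + S m) * beta_sum (a + RtoC (INR (j + S m)))))%C; [ring|].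
rewrite <- E. ring.
Qed.

Lemma beta_sum_eq_0 a k : off_poles a -> (a + RtoC (1 / 2))%C = (- RtoC (INR k))%C ->
  beta_sum a = RtoC 0.
Proof.
(* With k+1 factors the last one of (a+1/2)_(k+1) is a + 1/2 + k = 0, whereas (a)_(k+1) is
   nonzero. *)
intros Ha E. pose proof (beta_sum_shift a (S k) Ha) as H. simpl pochhammer in H.
rewrite E in H at 2.
replace (- RtoC (INR k) + RtoC (INR k))%C with (RtoC 0) in H by ring.
rewrite Cmult_0_r, Cmult_0_l in H.
destruct (Ceq_dec (beta_sum a) (RtoC 0)) as [|Hn]; auto.
exfalso. revert H. apply Cmult_neq_0; auto.
exact (pochhammer_neq_0 a (S k) Ha).
Qed.

Lemma beta_sum_Gamma a : off_poles a ->
  beta_sum a = (RtoC (sqrt PI) * Gamma a * rGamma (RtoC (1 / 2) + a))%C.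
Proof.
intros Ha. unfold rGamma.
destruct (excluded_middle_informative _) as [[k Hk]|H].
- rewrite (beta_sum_eq_0 a k); [ring|auto|]. rewrite <- Hk. ring.
- assert (Hb : off_poles (a + RtoC (1 / 2))%C).
  { intros k E. apply H. exists k.
    replace (RtoC (1 / 2) + a)%C with (a + RtoC (1 / 2) + RtoC (INR k) - RtoC (INR k))%C by ring.
    rewrite E. ring. }
  rewrite (Cplus_comm (RtoC (1 / 2))), <- beta_sum_mul_Gamma by auto.
  field. now apply Gamma_neq_0.
Qed.

(** * The tail of the series as a hypergeometric series *)

Lemma double_fact_pos n : (0 < double_fact n)%nat.
Proof.
enough (H : (0 < double_fact n)%nat /\ (0 < double_fact (S n))%nat) by apply H.
induction n as [|n [IH1 IH2]]; [simpl; lia|]. split; auto.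
change (double_fact (S (S n))) with (S (S n) * double_fact n)%nat. lia.
Qed.

Lemma double_fact_ratio n :
  INR (double_fact (1 + 2 * n)) / INR (double_fact (2 + 2 * n)) = cbin (S n).
Proof.
induction n as [|n IH].
- pose proof (cbin_S 0) as E. rewrite cbin_0 in E. simpl in *. lra.
- replace (1 + 2 * S n)%nat with (S (S (1 + 2 * n))) by lia.
  replace (2 + 2 * S n)%nat with (S (S (2 + 2 * n))) by lia.
  change (double_fact (S (S (1 + 2 * n)))) with (S (S (1 + 2 * n)) * double_fact (1 + 2 * n))%nat.
  change (double_fact (S (S (2 + 2 * n)))) with (S (S (2 + 2 * n)) * double_fact (2 + 2 * n))%nat.
  rewrite !mult_INR.
  pose proof (cbin_S (S n)) as E. rewrite <- IH in E.
  assert (Hd : INR (double_fact (2 + 2 * n)) <> 0)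
    by (apply not_0_INR; pose proof (double_fact_pos (2 + 2 * n)); lia).
  pose proof (pos_INR n).
  assert (E1 : INR (S (S (1 + 2 * n))) = 2 * INR n + 3)
    by (replace (S (S (1 + 2 * n))) with (2 * n + 3)%nat by lia; rewrite plus_INR, mult_INR; simpl; ring).
  assert (E2 : INR (S (S (2 + 2 * n))) = 2 * INR n + 4)
    by (replace (S (S (2 + 2 * n))) with (2 * n + 4)%nat by lia; rewrite plus_INR, mult_INR; simpl; ring).
  rewrite E1, E2. rewrite !S_INR in E.
  apply (Rmult_eq_reg_r (INR n + 1 + 1)); [|lra]. rewrite E. field. split; auto; lra.
Qed.

Lemma pochhammer_1 m : pochhammer (RtoC 1) m = RtoC (INR (fact m)).
Proof.
induction m as [|m IH]; [reflexivity|].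
rewrite fact_simpl, mult_INR, RtoC_mult. simpl pochhammer. rewrite IH, S_INR, RtoC_plus. ring.
Qed.

Lemma off_poles_add a n : off_poles a -> off_poles (a + RtoC (INR n))%C.
Proof.
intros Ha k. rewrite <- Cplus_assoc, <- RtoC_plus, <- plus_INR. apply Ha.
Qed.

(** A comparison of term ratios: from m to m+1 both sides gain (3/2+n+m)(1+a+n+m) /
    ((2+n+m)(2+a+n+m)). The upper parameter 1 cancels the m! of the hypergeometric term, and the
    prefactor is the first omitted term, k = n+1, by [double_fact_ratio]. *)
Lemma binom_term_tail a (n m : nat) : off_poles a ->
  binom_term a (S n + m) =
  (RtoC 1 / (RtoC 1 + a + RtoC (INR n))
     * (RtoC (INR (double_fact (1 + 2 * n))) / RtoC (INR (double_fact (2 + 2 * n))))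
     * hyp3F2_term (RtoC 1) (RtoC (3 / 2) + RtoC (INR n)) (RtoC 1 + a + RtoC (INR n))
         (RtoC 2 + RtoC (INR n)) (RtoC 2 + a + RtoC (INR n)) (RtoC 1) m)%C.
Proof.
intros Ha.
rewrite <- RtoC_div, double_fact_ratio
  by (apply not_0_INR; pose proof (double_fact_pos (2 + 2 * n)); lia).
assert (H1 : off_poles (RtoC 1 + a + RtoC (INR n))%C).
{ replace (RtoC 1 + a + RtoC (INR n))%C with (a + RtoC (INR (S n)))%C
    by (rewrite S_INR, RtoC_plus; ring). now apply off_poles_add. }
assert (H2 : off_poles (RtoC 2 + a + RtoC (INR n))%C).
{ replace (RtoC 2 + a + RtoC (INR n))%C with (a + RtoC (INR (S (S n))))%C
    by (rewrite !S_INR, !RtoC_plus; ring). now apply off_poles_add. }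
assert (H3 : off_poles (RtoC 2 + RtoC (INR n))%C).
{ replace (RtoC 2 + RtoC (INR n))%C with (RtoC (INR (S (S n))))
    by (rewrite !S_INR, !RtoC_plus; ring). apply off_poles_INR_S. }
unfold hyp3F2_term. rewrite pochhammer_1, Cpow_1_l.
induction m as [|m IH].
- rewrite Nat.add_0_r, binom_term_cbin. cbn [pochhammer fact]. change (INR 1) with 1.
  pose proof (H1 0%nat) as H. simpl in H.
  rewrite S_INR, RtoC_plus. replace (a + (RtoC (INR n) + RtoC 1))%C with (RtoC 1 + a + RtoC (INR n))%C by ring.
  field. intros E; apply H; rewrite E; ring.
- assert (Hf : forall k, RtoC (INR (fact k)) <> RtoC 0)
    by (intros; apply RtoC_neq_0, INR_fact_neq_0).
  assert (step : binom_term a (S n + S m) = (binom_term a (S n + m)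
     * ((RtoC (3 / 2) + RtoC (INR n) + RtoC (INR m)) / (RtoC 2 + RtoC (INR n) + RtoC (INR m)))
     * ((RtoC 1 + a + RtoC (INR n) + RtoC (INR m)) / (RtoC 2 + a + RtoC (INR n) + RtoC (INR m))))%C).
  { rewrite !binom_term_cbin.
    replace (S n + S m)%nat with (S (S n + m)) by lia.
    pose proof (cbin_S (S n + m)) as E. pose proof (pos_INR n). pose proof (pos_INR m).
    rewrite S_INR, plus_INR, S_INR in *.
    assert (E' : cbin (S (S n + m)) = cbin (S n + m) * ((3 / 2 + INR n + INR m) / (2 + INR n + INR m))).
    { apply (Rmult_eq_reg_r (INR n + 1 + INR m + 1)); [|lra]. rewrite E. field. lra. }
    rewrite E', RtoC_mult, RtoC_div, !RtoC_plus by lra.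
    pose proof (H1 m) as K1. pose proof (H2 m) as K2. pose proof (H3 m) as K3.
    replace (a + (RtoC (INR n) + RtoC 1 + RtoC (INR m) + RtoC 1))%C
      with (RtoC 2 + a + RtoC (INR n) + RtoC (INR m))%C by ring.
    replace (a + (RtoC (INR n) + RtoC 1 + RtoC (INR m)))%C
      with (RtoC 1 + a + RtoC (INR n) + RtoC (INR m))%C by ring.
    set (w2 := (RtoC 2 + a + RtoC (INR n) + RtoC (INR m))%C) in *.
    set (w1 := (RtoC 1 + a + RtoC (INR n) + RtoC (INR m))%C) in *.
    set (w3 := (RtoC 2 + RtoC (INR n) + RtoC (INR m))%C) in *.
    field. auto. }
  rewrite step, IH. simpl pochhammer.
  pose proof (H1 m) as K1. pose proof (H2 m) as K2. pose proof (H3 m) as K3.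
  pose proof (pochhammer_neq_0 _ m H2) as P2. pose proof (pochhammer_neq_0 _ m H3) as P3.
  pose proof (H1 0%nat) as K0. simpl in K0. rewrite Cplus_0_r in K0.
  set (w2 := (RtoC 2 + a + RtoC (INR n) + RtoC (INR m))%C) in *.
  set (w1 := (RtoC 1 + a + RtoC (INR n) + RtoC (INR m))%C) in *.
  set (w3 := (RtoC 2 + RtoC (INR n) + RtoC (INR m))%C) in *.
  set (w4 := (RtoC (3 / 2) + RtoC (INR n) + RtoC (INR m))%C) in *.
  set (p2 := pochhammer (RtoC 2 + a + RtoC (INR n)) m) in *.
  set (p3 := pochhammer (RtoC 2 + RtoC (INR n)) m) in *.
  set (q := (RtoC 1 + a + RtoC (INR n))%C) in *.
  pose proof (Hf m). pose proof (Hf (S m)).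
  field. repeat split; auto.
Qed.

Lemma is_Cseries_binom_tail a n : is_Cseries (fun m => binom_term a (S n + m)) (beta_sum a - Csum_n (binom_term a) n)%C.
Proof.
apply (is_series_incr_n (K := C_AbsRing) (V := C_NormedModule)); [lia|].
simpl pred.
replace (plus _ _) with (beta_sum a); [apply is_Cseries_beta_sum|].
change (beta_sum a = (beta_sum a - Csum_n (binom_term a) n) + Csum_n (binom_term a) n)%C. ring.
Qed.

Theorem mainTheorem8 (alpha : C)
  (Halpha : forall j : nat, alpha <> (- RtoC (INR (S j)))%C) :
  (alpha <> RtoC 0 ->
     is_series (K := C_AbsRing) (V := C_NormedModule)
       (fun k : nat => binom_term alpha (S k))
       (RtoC (sqrt PI) * Gamma alpha * rGamma (RtoC (1 / 2) + alpha)
          - RtoC 1 / alpha)%C)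
  /\
  (alpha = RtoC 0 ->
     is_series (K := C_AbsRing) (V := C_NormedModule)
       (fun k : nat => binom_term alpha (S k))
       (RtoC (2 * ln 2)))
  /\
  (alpha <> RtoC 0 ->
     forall n : nat, (1 <= n)%nat ->
       ex_series (K := C_AbsRing) (V := C_NormedModule)
         (hyp3F2_term
            (RtoC 1) (RtoC (3 / 2) + RtoC (INR n))%C
            (RtoC 1 + alpha + RtoC (INR n))%C
            (RtoC 2 + RtoC (INR n))%C (RtoC 2 + alpha + RtoC (INR n))%C
            (RtoC 1))
       /\
       sum_n_m (G := C_AbelianMonoid) (binom_term alpha) 1 n =
         (RtoC (sqrt PI) * Gamma alpha * rGamma (RtoC (1 / 2) + alpha)
            - RtoC 1 / alpha
            - RtoC 1 / (RtoC 1 + alpha + RtoC (INR n))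
              * (RtoC (INR (double_fact (1 + 2 * n)))
                 / RtoC (INR (double_fact (2 + 2 * n))))
              * hyp3F2
                  (RtoC 1) (RtoC (3 / 2) + RtoC (INR n))
                  (RtoC 1 + alpha + RtoC (INR n))
                  (RtoC 2 + RtoC (INR n)) (RtoC 2 + alpha + RtoC (INR n))
                  (RtoC 1))%C).
Proof.
assert (Hoff : alpha <> RtoC 0 -> off_poles alpha).
{ intros H0 [|j] E.
  - apply H0. rewrite <- E. simpl. ring.
  - apply (Halpha j).
    replace alpha with (alpha + RtoC (INR (S j)) - RtoC (INR (S j)))%C by ring.
    rewrite E. ring. }
assert (T0 : binom_term alpha 0 = (RtoC 1 / alpha)%C).
{ rewrite binom_term_cbin, cbin_0. simpl (INR 0). rewrite Cplus_0_r. reflexivity. }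
split; [|split].
- intros H0. rewrite <- beta_sum_Gamma by auto.
  (* The sum from k = 1 is the tail after the single term 1/alpha. *)
  pose proof (is_Cseries_binom_tail alpha 0) as H. rewrite Csum_n_0, T0 in H. exact H.
- intros H0. rewrite H0.
  apply is_Cseries_Clim.
  apply (Clim_ext (fun n => RtoC (sum_n (fun k => cbin_div (S k)) n))).
  + assert (E : forall k, binom_term (RtoC 0) (S k) = RtoC (cbin_div (S k))).
    { intros k. rewrite binom_term_cbin, Cplus_0_l. unfold cbin_div.
      rewrite RtoC_div by (apply not_0_INR; lia). reflexivity. }
    intros n. induction n as [|n IH].
    * rewrite Csum_n_0, sum_O, E. reflexivity.
    * rewrite Csum_n_S, sum_Sn, <- IH, E. apply RtoC_plus.
  + apply Clim_RtoC.
    apply (is_series_incr_1 cbin_div (2 * ln 2)).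
    replace (plus _ _) with (2 * ln 2); [apply is_series_cbin_div|].
    change (2 * ln 2 = 2 * ln 2 + 0). ring.
- intros H0 n Hn.
  specialize (Hoff H0). rewrite <- beta_sum_Gamma by auto.
  set (q := (RtoC 1 / (RtoC 1 + alpha + RtoC (INR n))
     * (RtoC (INR (double_fact (1 + 2 * n))) / RtoC (INR (double_fact (2 + 2 * n)))))%C).
  (* The prefactor must be nonzero: convergence and value of the hypergeometric series come from
     dividing the convergent tail by q. *)
  assert (Hq : q <> RtoC 0).
  { assert (Hd : forall k, RtoC (INR (double_fact k)) <> RtoC 0)
      by (intros k; apply RtoC_neq_0, not_0_INR; pose proof (double_fact_pos k); lia).
    assert (Hw : (RtoC 1 + alpha + RtoC (INR n))%C <> RtoC 0).
    { intros E. apply (Hoff (S n)). rewrite S_INR, RtoC_plus, <- E. ring. }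
    apply Cmult_neq_0; apply Cmult_neq_0; auto using C1_nz.
    - intros E. apply C1_nz. rewrite <- (Cinv_r _ Hw), E. ring.
    - intros E. apply C1_nz. rewrite <- (Cinv_r _ (Hd (2 + 2 * n)%nat)), E. ring. }
  set (h := hyp3F2_term _ _ _ _ _ _).
  assert (Hs : is_Cseries h (/ q * (beta_sum alpha - Csum_n (binom_term alpha) n))%C).
  { apply (is_series_ext (K := C_AbsRing) (V := C_NormedModule)
      (fun m => scal (/ q)%C (binom_term alpha (S n + m) : C_NormedModule))).
    - intros m. rewrite binom_term_tail by auto. fold h q.
      change (/ q * (q * h m) = h m)%C. field. auto.
    - apply (is_series_scal (K := C_AbsRing) (V := C_NormedModule)), is_Cseries_binom_tail. }
  split; [now exists (/ q * (beta_sum alpha - Csum_n (binom_term alpha) n))%C|].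
  unfold hyp3F2. fold h. rewrite (CSeries_unique _ _ Hs).
  (* The sum from 1 to n is the sum from 0 to n without its term 1/alpha; what then remains is that
     q times the hypergeometric sum is the tail. *)
  transitivity (Csum_n (binom_term alpha) n - RtoC 1 / alpha)%C.
  + unfold sum_n. rewrite (sum_Sn_m (G := C_AbelianMonoid) (binom_term alpha) 0 n), T0 by lia.
    exact (Cplus_sub_cancel_l _ _).
  + match goal with |- ?x = ?y => change (@eq C x y) end. field. auto.
Qed.
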